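(* Let $(R,\mathfrak m,k)$ be an Artinian generalized Golod Gorenstein local ring which is not a field. Then the ring $R/\operatorname{soc}R$ satisfies Tor-vanishing.
   Context: All rings are commutative Noetherian local rings with $1\neq 0$, and all modules are finitely generated. Let $R$ be a local ring with maximal ideal $\mathfrak m$ and residue field $k=R/\mathfrak m$. $\operatorname{soc}R=(0:_R\mathfrak m)$ is the socle. Tor-vanishing: a local ring $S$ satisfies Tor-vanishing if for all finitely generated $S$-modules $M,N$, $\operatorname{Tor}^S_i(M,N)=0$ for all $i\gg0$ implies that $M$ or $N$ has finite projective dimension. Acyclic closure: the acyclic closure $R\langle X\rangle$ of $k$ over $R$ is the DG $R$-algebra resolution of $k$ obtained from $R$ by Tate's process of killing cycles in a minimal way: one adjoins exterior variables in odd degrees and divided power variables in even degrees, the degree $1$ variables being mapped by the differential onto a minimal generating set of $\mathfrak m$, and, for $n\ge 1$, the degree $n+1$ variables being mapped to cycles whose classes form a minimal generating set of $H_n(R\langle X_{\le n}\rangle)$. Here $R\langle X_{\le n}\rangle$ is the DG subalgebra generated by the variables of degree at most $n$. Trivial Massey operation: let $U$ be such a DG algebra with augmentation $U\to k$, and set $\overline a=(-1)^{d+1}a$ for $a\in U_d$ (extended additively). $U$ admits a trivial Massey operation if to each finite sequence $v_1,\dots,v_n$ ($n\ge 1$) of elements of $\widetilde H(U)=\ker(H(U)\to k)$ one can assign an element $\gamma(v_1,\dots,v_n)\in\ker(U\to k)$ such that (i) $\gamma(v)$ is a cycle representing the homology class $v$ for each $v\in\widetilde H(U)$, and (ii) $d\gamma(v_1,\dots,v_n)=\sum_{j=1}^{n-1}\overline{\gamma(v_1,\dots,v_j)}\,\gamma(v_{j+1},\dots,v_n)$.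 Generalized Golod ring: $R$ is generalized Golod (of level $\le q$, where $q\geq 1$) if $R\langle X_{\le q}\rangle$ admits a trivial Massey operation; $R$ is generalized Golod if this holds for some $q$. *)

(* Defs.v *)
From HB Require Import structures.
From mathcomp Require Import all_boot all_algebra finmap.
From mathcomp Require Import boolp classical_sets.

Set Implicit Arguments.
Unset Strict Implicit.
Unset Printing Implicit Defensive.

Import GRing.Theory.

Local Open Scope classical_set_scope.
Local Open Scope ring_scope.

Definition is_ideal (R : comNzRingType) (J : set R) : Prop :=
  [/\ J 0, (forall x y, J x -> J y -> J (x + y))
    & (forall a x, J x -> J (a * x))].

Definition maximal_ideal (R : comNzRingType) (J : set R) : Prop :=
  [/\ is_ideal J, ~ J 1
    & forall K : set R, is_ideal K -> ~ K 1 -> J `<=` K -> K = J].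

Definition noetherian_ring (R : comNzRingType) : Prop :=
  forall J : nat -> set R, (forall n, is_ideal (J n)) ->
    (forall n, J n `<=` J n.+1) ->
    exists n0, forall n, (n0 <= n)%N -> J n = J n0.

Definition artinian_ring (R : comNzRingType) : Prop :=
  forall J : nat -> set R, (forall n, is_ideal (J n)) ->
    (forall n, J n.+1 `<=` J n) ->
    exists n0, forall n, (n0 <= n)%N -> J n = J n0.

Definition local_ring (R : comNzRingType) (m : set R) : Prop :=
  [/\ noetherian_ring R, maximal_ideal m
    & forall K : set R, maximal_ideal K -> K = m].

Definition is_field (R : comNzRingType) : Prop :=
  forall x : R, x != 0 -> exists y, x * y = 1.

Definition socle (R : comNzRingType) (m : set R) : set R :=
  [set x | forall a, m a -> a * x = 0].

Definition finitely_generated (S : comNzRingType) (M : lmodType S) : Prop :=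
  exists (n : nat) (g : 'I_n -> M),
    forall x, exists c : 'I_n -> S, x = \sum_(i < n) c i *: g i.

Definition projective_module (S : comNzRingType) (P : lmodType S) : Prop :=
  forall (A B : lmodType S) (g : {linear A -> B}) (f : {linear P -> B}),
    (forall b, exists a, g a = b) ->
    exists h : {linear P -> A}, forall x, g (h x) = f x.

Definition injective_module (S : comNzRingType) (E : lmodType S) : Prop :=
  forall (A B : lmodType S) (f : {linear A -> B}) (g : {linear A -> E}),
    injective f -> exists h : {linear B -> E}, forall a, h (f a) = g a.

Record proj_resolution (S : comNzRingType) (M : lmodType S) := ProjResolution {
  pr_mod : nat -> lmodType S;
  pr_diff : forall i, {linear pr_mod i.+1 -> pr_mod i};
  pr_aug : {linear pr_mod 0%N -> M};
  pr_projective : forall i, projective_module (pr_mod i);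
  pr_aug_surj : forall x, exists y, pr_aug y = x;
  pr_exact0 : forall y, pr_aug y = 0 <-> exists z, pr_diff 0 z = y;
  pr_exact : forall i y, pr_diff i y = 0 <-> exists z, pr_diff i.+1 z = y
}.

Definition finite_projective_dimension (S : comNzRingType) (M : lmodType S) :
    Prop :=
  exists (P : proj_resolution M) (n : nat),
    forall i, (n < i)%N -> forall x : pr_mod P i, x = 0.

Record inj_resolution (S : comNzRingType) (M : lmodType S) := InjResolution {
  ir_mod : nat -> lmodType S;
  ir_diff : forall i, {linear ir_mod i -> ir_mod i.+1};
  ir_aug : {linear M -> ir_mod 0%N};
  ir_injective : forall i, injective_module (ir_mod i);
  ir_aug_inj : injective ir_aug;
  ir_exact0 : forall y, ir_diff 0 y = 0 <-> exists x, ir_aug x = y;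
  ir_exact : forall i y, ir_diff i.+1 y = 0 <-> exists z, ir_diff i z = y
}.

Definition finite_injective_dimension (S : comNzRingType) (M : lmodType S) :
    Prop :=
  exists (E : inj_resolution M) (n : nat),
    forall i, (n < i)%N -> forall x : ir_mod E i, x = 0.

Definition gorenstein_ring (R : comNzRingType) : Prop :=
  finite_injective_dimension (R^o : lmodType R).

(* An element of the tensor product of [M] and [N] is represented by a formal
   sum [(x_1, y_1), ..., (x_n, y_n)] of pure tensors; two formal sums represent
   the same element iff no bilinear map separates them. *)
Definition tensor_eq (S : comNzRingType) (M N : lmodType S)
    (s t : seq (M * N)) : Prop :=
  forall (W : lmodType S) (f : {bilinear M -> N -> W}),
    \sum_(p <- s) f p.1 p.2 = \sum_(p <- t) f p.1 p.2.

(* The map induced by [f] from the tensor product of [A] and [N] to that of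
   [B] and [N]. *)
Definition tensor_map (S : comNzRingType) (A B N : lmodType S)
    (f : {linear A -> B}) (s : seq (A * N)) : seq (B * N) :=
  [seq (f p.1, p.2) | p <- s].

Definition tensor_cycle (S : comNzRingType) (M N : lmodType S)
    (P : proj_resolution M) (i : nat) : seq (pr_mod P i * N) -> Prop :=
  match i with
  | 0%N => fun _ => True
  | j.+1 => fun z => tensor_eq (tensor_map (pr_diff P j) z) [::]
  end.

(* Tor_i(M, N) = 0. Quantifying over all projective resolutions is the same as
   fixing one, the homology being independent of the resolution. *)
Definition tor_eq0 (S : comNzRingType) (i : nat) (M N : lmodType S) : Prop :=
  forall (P : proj_resolution M) (z : seq (pr_mod P i * N)),
    tensor_cycle z ->
    exists w : seq (pr_mod P i.+1 * N),
      tensor_eq (tensor_map (pr_diff P i) w) z.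

Definition tor_vanishing (S : comNzRingType) : Prop :=
  forall M N : lmodType S, finitely_generated M -> finitely_generated N ->
    (exists n0, forall i, (n0 <= i)%N -> tor_eq0 i M N) ->
    finite_projective_dimension M \/ finite_projective_dimension N.

Definition monomial (X : choiceType) : Type := {fsfun X -> nat with 0%N}.
HB.instance Definition _ (X : choiceType) :=
  [Choice of monomial X by <:].

Section Monomials.
Variables (X : choiceType) (deg : X -> nat).
Implicit Type e : monomial X.

(* Exterior (odd) variables occur with exponent at most 1. *)
Definition admissible e : Prop := forall x, odd (deg x) -> (e x <= 1)%N.

Definition mdegree e : nat := (\sum_(x <- finsupp e) e x * deg x)%N.

Variables (R : comNzRingType) (U : algType R) (dp : X -> nat -> U).

(* The enumeration of [finsupp e] only affects the sign of the product. *)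
Definition monomial_value e : U := \prod_(x <- finsupp e) dp x (e x).

Definition combination (c : {fsfun monomial X -> R with 0}) : U :=
  \sum_(e <- finsupp c) c e *: monomial_value e.

End Monomials.

(* The DG [R]-algebra R<X>. The element [dg_dp x j] is the j-th divided power
   x^(j), so that the variable itself is [dg_dp x 1]; for x of odd degree
   x^(j) = 0 as soon as j >= 2. The underlying module is free on the admissible
   monomials, and [dg_coord] gives the coordinates in this basis. *)
Record dg_extension (R : comNzRingType) := DGExtension {
  dg_alg :> algType R;
  dg_var : choiceType;
  dg_deg : dg_var -> nat;
  dg_dp : dg_var -> nat -> dg_alg;
  dg_diff : {linear dg_alg -> dg_alg};
  dg_coord : dg_alg -> {fsfun monomial dg_var -> R with 0};
  dg_homog := fun (n : nat) (u : dg_alg) =>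
    forall e, dg_coord u e != 0 -> mdegree dg_deg e = n;
  dg_deg_gt0 : forall x, (0 < dg_deg x)%N;
  dg_coord_admissible :
    forall u e, dg_coord u e != 0 -> admissible dg_deg e;
  dg_coordK : forall u, combination dg_dp (dg_coord u) = u;
  dg_combinationK : forall c : {fsfun monomial dg_var -> R with 0},
    (forall e, c e != 0 -> admissible dg_deg e) ->
    dg_coord (combination dg_dp c) = c;
  dg_homogM : forall i j u v, dg_homog i u -> dg_homog j v ->
    dg_homog (i + j)%N (u * v);
  dg_commute : forall i j u v, dg_homog i u -> dg_homog j v ->
    u * v = (-1) ^+ (i * j)%N * (v * u);
  dg_dp0 : forall x, dg_dp x 0 = 1;
  dg_dpM : forall x i j,
    dg_dp x i * dg_dp x j = dg_dp x (i + j)%N *+ 'C((i + j)%N, i);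
  dg_dp_odd : forall x j, odd (dg_deg x) -> dg_dp x j.+2 = 0;
  dg_diff_homog0 : forall u, dg_homog 0 u -> dg_diff u = 0;
  dg_diff_homog : forall n u, dg_homog n.+1 u -> dg_homog n (dg_diff u);
  dg_diff_diff : forall u, dg_diff (dg_diff u) = 0;
  dg_leibniz : forall i u v, dg_homog i u ->
    dg_diff (u * v) = dg_diff u * v + (-1) ^+ i * (u * dg_diff v);
  dg_diff_dp : forall x j, ~~ odd (dg_deg x) ->
    dg_diff (dg_dp x j.+1) = dg_diff (dg_dp x 1) * dg_dp x j
}.

Section AcyclicClosure.
Variables (R : comNzRingType) (m : set R) (A : dg_extension R).

(* The underlying set of R<X_{<=n}>. *)
Definition dg_sub (n : nat) : set A :=
  [set u | forall e : monomial (dg_var A), dg_coord u e != 0 ->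
           forall x, e x != 0 -> (dg_deg x <= n)%N].

(* What the variables of degree n+1 have to kill: m if n = 0, and the n-cycles
   of R<X_{<=n}> if n >= 1. *)
Definition killed_cycle (n : nat) : set A :=
  if n is 0%N then [set z | exists2 r, m r & z = r%:A]
  else [set z | [/\ dg_sub n z, dg_homog n z & dg_diff A z = 0]].

(* Modulo the boundaries of R<X_{<=n}>, the differentials of the variables of
   degree n+1 lying in Y generate [killed_cycle n]. For n = 0 there are no
   nonzero boundaries. *)
Definition kills (n : nat) (Y : set (dg_var A)) : Prop :=
  forall z, killed_cycle n z ->
    exists (a : {fsfun dg_var A -> R with 0}) (b : A),
      [/\ forall x, a x != 0 -> dg_deg x = n.+1 /\ Y x,
          dg_sub n b, dg_homog n.+1 b &
          z = \sum_(x <- finsupp a) a x *: dg_diff A (dg_dp x 1)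
              + dg_diff A b].

Definition acyclic_closure : Prop :=
  forall n,
    [/\ forall x : dg_var A, dg_deg x = n.+1 ->
          killed_cycle n (dg_diff A (dg_dp x 1)),
        kills n setT &
        forall x : dg_var A, dg_deg x = n.+1 ->
          ~ kills n [set y | y <> x]].

(* The kernel of the augmentation to R/m: the coefficient of the empty monomial
   lies in m. *)
Definition aug_kernel : set A :=
  [set u | m (dg_coord u ([fsfun] : monomial (dg_var A)))].

(* The additive map a |-> (-1)^(d+1) a on elements a of degree d. *)
Definition dg_bar (u : A) : A :=
  \sum_(e <- finsupp (dg_coord u))
    ((-1) ^+ (mdegree (@dg_deg _ A) e).+1 * dg_coord u e)
      *: monomial_value (@dg_dp _ A) e.

Variable q : nat.

Definition homology_class (z : A) : set A :=
  [set w | exists2 b, dg_sub q b & w = z + dg_diff A b].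

(* ker (H(R<X_{<=q}>) -> k); a homology class is the set of its cycles. *)
Definition reduced_homology : Type :=
  {h : set A | exists z, [/\ dg_sub q z, dg_diff A z = 0, aug_kernel z
                           & h = homology_class z]}.

(* The value of [gamma] on the empty sequence is irrelevant. *)
Definition trivial_massey_operation : Prop :=
  exists gamma : seq reduced_homology -> A,
    [/\ forall vs, (0 < size vs)%N ->
          dg_sub q (gamma vs) /\ aug_kernel (gamma vs),
        forall v, sval v (gamma [:: v]) &
        forall vs, (0 < size vs)%N ->
          dg_diff A (gamma vs) =
          \sum_(1 <= j < size vs)
            dg_bar (gamma (take j vs)) * gamma (drop j vs)].

End AcyclicClosure.

(* Acyclic closures are unique up to isomorphism, so that it does not matter
   which one is used. *)
Definition generalized_golod_level (R : comNzRingType) (m : set R) (q : nat) :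
    Prop :=
  exists A : dg_extension R,
    acyclic_closure m A /\ trivial_massey_operation m A q.

Definition generalized_golod (R : comNzRingType) (m : set R) : Prop :=
  exists2 q, (1 <= q)%N & generalized_golod_level m q.

(* Main.v *)
From HB Require Import structures.
Require Import Defs.
From mathcomp Require Import all_boot all_algebra.
From mathcomp Require Import boolp classical_sets.
From mathcomp Require Import sesquilinear ring.

Set Implicit Arguments.
Unset Strict Implicit.
Unset Printing Implicit Defensive.

Import GRing.Theory.

Local Open Scope ring_scope.

(* Let S = R/soc R, with maximal ideal n, and let F be the minimal resolution of
   a non-free S-module M.  Write J for the annihilator in R of
   soc_2 R = (soc R : m).

   Suppose m <> Ra + J for all a in m.  Lift the differentials d_i of F to
   matrices over R.  Then some lifted d_3 has an entry outside J.  Indeed let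
   s = d_1 v be a nonzero socle element of the first syzygy and a in m with
   a s <> 0 after lifting to R; take b in m outside Ra + J, and write
   a v = d_2 z_a, b v = d_2 z_b.  The syzygy b z_a - a z_b lies in the image of
   d_3, so if this image were in J F_2, then z_a would lie in n F_2; but the
   lift of d_1 d_2 has entries in soc R and kills m F_2, whereas it sends z_a to
   a s <> 0.  An entry t outside J with r t <> 0, r in soc_2 R, makes the socle
   element r e_i of F_3 a minimal generator of ker d_3: the residue field k is a
   direct summand of the fourth syzygy.  This applies to every syzygy of M, so
   if Tor_i(M, N) vanishes for large i, then Tor_1(k, N) = 0 and N is free.

   Suppose m = Ra + J for some a.  As R is Gorenstein Artinian, it is self-injective, so
   every linear map m -> soc R is multiplication by an element of soc_2 R; hence
   J is contained in m^2 and m = Ra.  Over the principal ring S, with H minimal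
   such that a^H = 0, a nonzero minimal differential is a^i D with 0 < i < H and
   D having a unit entry.  Vanishing of Tor says (0 :_N a^i) = a^(H-i) N, which
   forces N to be free. *)

(** * Ideals of a Noetherian ring *)

Section Ideals.
Variable A : comNzRingType.
Implicit Types (I J : set A) (a x : A).

Lemma ideal0 I : is_ideal I -> I 0.
Proof. by case. Qed.

Lemma idealD I x y : is_ideal I -> I x -> I y -> I (x + y).
Proof. by case=> _ + _; apply. Qed.

Lemma idealMl I a x : is_ideal I -> I x -> I (a * x).
Proof. by case=> _ _; apply. Qed.

Lemma idealMr I x a : is_ideal I -> I x -> I (x * a).
Proof. by move=> hI Ix; rewrite mulrC; apply: idealMl. Qed.

Lemma idealN I x : is_ideal I -> I x -> I (- x).
Proof. by move=> hI Ix; rewrite -mulN1r; apply: idealMl. Qed.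

Lemma idealB I x y : is_ideal I -> I x -> I y -> I (x - y).
Proof. by move=> hI Ix Iy; apply: idealD => //; apply: idealN. Qed.

Lemma ideal_sum I (T : Type) (s : seq T) (P : pred T) (F : T -> A) :
  is_ideal I -> (forall i, P i -> I (F i)) -> I (\sum_(i <- s | P i) F i).
Proof.
move=> hI hF; apply: big_ind => //; first exact: ideal0.
by move=> x y; apply: idealD.
Qed.

Definition adjoin I x : set A := [set y | exists2 i, I i & exists a, y = i + a * x].

Lemma adjoin_ideal I x : is_ideal I -> is_ideal (adjoin I x).
Proof.
move=> hI; split.
- by exists 0; [exact: ideal0|exists 0; rewrite mul0r addr0].
- move=> _ _ [i Ii [a ->]] [j Ij [b ->]].
  by exists (i + j); [exact: idealD|exists (a + b); ring].
- move=> c _ [i Ii [a ->]].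
  by exists (c * i); [exact: idealMl|exists (c * a); ring].
Qed.

Lemma sub_adjoin I x : (I `<=` adjoin I x)%classic.
Proof. by move=> i Ii; exists i => //; exists 0; rewrite mul0r addr0. Qed.

Lemma mem_adjoin I x : is_ideal I -> adjoin I x x.
Proof. by move=> hI; exists 0; [exact: ideal0|exists 1; rewrite mul1r add0r]. Qed.

Lemma zero_ideal : is_ideal [set (0 : A)]%classic.
Proof.
split=> [|x y|a x] //=; first by move=> -> ->; rewrite addr0.
by move=> ->; rewrite mulr0.
Qed.

Hypothesis Anoeth : noetherian_ring A.

(** A counterexample [I0] would start a strictly ascending chain [J], built by repeated choice. *)
Lemma noetherian_ind (P : set A -> Prop) :
  (forall I, is_ideal I ->
    (forall I', is_ideal I' -> (I `<=` I')%classic -> I' <> I -> P I') -> P I) ->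
  forall I, is_ideal I -> P I.
Proof.
move=> step I0 hI0; apply: contrapT => nP.
pose T := {I : set A | is_ideal I /\ ~ P I}.
have next (t : T) : {t' : T | (sval t `<=` sval t')%classic /\ sval t' <> sval t}.
  apply: cid; case: t => I [hI nPI] /=; apply: contrapT => h.
  apply: nPI; apply: step => // I' hI' sII' neq; apply: contrapT => nPI'.
  by apply: h; exists (exist _ I' (conj hI' nPI')).
pose J := fix J n : T := if n is n'.+1 then sval (next (J n')) else exist _ I0 (conj hI0 nP).
have [n hn] : exists n0, forall n, (n0 <= n)%N -> sval (J n) = sval (J n0).
  apply: Anoeth => n; first by case: (J n) => ? [].
  by rewrite /=; case: (next (J n)) => ? [].
have := hn n.+1 (leqnSn n); rewrite /=; case: (next (J n)) => t [_ /= h]; exact: h.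
Qed.

Lemma noetherian_max (P : set A -> Prop) I : is_ideal I -> P I ->
  exists J, [/\ is_ideal J, P J, (I `<=` J)%classic &
    forall K, is_ideal K -> P K -> (J `<=` K)%classic -> K = J].
Proof.
move: I; apply: noetherian_ind => I hI IH PI.
case: (pselect (exists K, [/\ is_ideal K, P K, (I `<=` K)%classic & K <> I])).
  move=> [K [hK PK sIK neq]]; have [J [hJ PJ sKJ maxJ]] := IH K hK sIK neq PK.
  by exists J; split=> //; apply: subset_trans sKJ.
move=> h; exists I; split=> // K hK PK sIK; apply: contrapT => neq.
by apply: h; exists K.
Qed.

End Ideals.

(* A chain witnessing that [m] is nilpotent. *)
Definition loewy (A : comNzRingType) (m : set A) (Z : nat -> set A) (h : nat) : Prop :=
  [/\ forall x, Z 0%N x -> x = 0, Z h 1 &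
      forall i x a, Z i.+1 x -> m a -> Z i (a * x)].

(** * Local rings, and nilpotence of the maximal ideal in the Artinian case *)

Section Local.
Variables (A : comNzRingType) (m : set A).
Hypothesis mloc : local_ring m.

Lemma local_ideal : is_ideal m.
Proof. by case: mloc => _ []. Qed.

Lemma local_unit x : ~ m x -> exists y, x * y = 1.
Proof.
case: mloc => Anoeth _ uniq nmx; apply: contrapT => nu.
pose I := adjoin [set (0 : A)]%classic x.
have hI : is_ideal I by apply/adjoin_ideal/zero_ideal.
have nI1 : ~ I 1.
  by move=> [i -> [a e]]; apply: nu; exists a; rewrite e add0r mulrC.
have [J [hJ nJ1 sIJ maxJ]] := noetherian_max Anoeth (P := fun J => ~ J 1) hI nI1.
have eJ : J = m by apply: uniq; split=> // K hK nK1; apply: maxJ.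
by apply: nmx; rewrite -eJ; apply: sIJ; apply/mem_adjoin/zero_ideal.
Qed.

(** The ascending Loewy series: the [i]-th term is the annihilator of the [i]-th power of [m]. *)
Fixpoint upper_socle (i : nat) : set A :=
  if i is i'.+1 then [set x | forall a, m a -> upper_socle i' (a * x)]%classic
  else [set 0]%classic.

Lemma upper_socle_ideal i : is_ideal (upper_socle i).
Proof.
elim: i => [|i [h0 hD hM]]; first exact: zero_ideal.
split=> /= [a _|x y hx hy a ma|c x hx a ma]; first by rewrite mulr0.
  by rewrite mulrDr; apply: hD; [apply: hx|apply: hy].
by rewrite mulrCA; apply/hM/hx.
Qed.

Lemma upper_socleS i : (upper_socle i `<=` upper_socle i.+1)%classic.
Proof.
by move=> x hx a _; apply: idealMl => //; apply: upper_socle_ideal.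
Qed.

(** The series is stationary from some [h] on. If that term missed 1, every element outside it would
    have an [m]-multiple outside it, giving a descending chain of principal ideals; where the chain
    stops, [x = c * a * x] with [1 - c * a] a unit, so [x = 0]. *)
Lemma artinian_loewy : artinian_ring A -> exists h, loewy m upper_socle h.
Proof.
move=> Aart; have [h hh] : exists n0, forall n, (n0 <= n)%N ->
    upper_socle n = upper_socle n0.
  case: mloc => Anoeth _ _; apply: Anoeth; first exact: upper_socle_ideal.
  exact: upper_socleS.
exists h; split=> [//||i x a hx ma]; last exact: hx.
apply: contrapT => n1.
pose T := {x : A | ~ upper_socle h x}.
have next (t : T) : {a : A | m a /\ ~ upper_socle h (a * sval t)}.
  apply: cid; case: t => x /= nx; apply: contrapT => hx; apply: nx.
  rewrite -(hh h.+1) // => a ma; apply: contrapT => hax.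
  by apply: hx; exists a.
pose nx t : T := let s := next t in exist _ (sval s * sval t) (svalP s).2.
pose x n : T := iter n nx (exist _ 1 n1).
pose J n := adjoin [set (0 : A)]%classic (sval (x n)).
have [n hn] : exists n0, forall n, (n0 <= n)%N -> J n = J n0.
  apply: Aart => [n|n]; first exact/adjoin_ideal/zero_ideal.
  move=> _ [_ -> [a ->]]; exists 0 => //; exists (a * sval (next (x n))).
  by rewrite -mulrA.
have : J n.+1 (sval (x n)) by rewrite hn //; apply/mem_adjoin/zero_ideal.
move=> [_ -> [c]]; rewrite add0r /x iterS -/(x n) /=.
case: (next (x n)) => a [ma na] /= e.
have [|y hy] := @local_unit (1 - c * a).
  move=> h1; case: mloc => _ [_ nm1 _] _; apply: nm1.
  rewrite -[1](subrK (c * a)); apply: idealD => //; first exact: local_ideal.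
  by apply: idealMl => //; exact: local_ideal.
have x0 : sval (x n) = 0.
  rewrite -[LHS]mul1r -hy mulrAC mulrBl mul1r -mulrA -e subrr mul0r //.
by apply: na; rewrite x0 mulr0; apply: ideal0; apply: upper_socle_ideal.
Qed.

End Local.

(** * Linear maps defined on an ideal, and their extension *)

Section IdealModule.
Variables (A : comNzRingType) (I : set A) (hI : is_ideal I).

Definition ideal_pred : {pred A^o} := fun x => `[< I x >].

Lemma ideal_submod_closed : submod_closed ideal_pred.
Proof.
split=> [|a x y] /=; first by apply/asboolP; apply: ideal0.
move=> /asboolP Ix /asboolP Iy; apply/asboolP.
by apply: idealD => //; apply: idealMl.
Qed.
End IdealModule.

Definition ideal_mem (A : comNzRingType) (I : set A) of is_ideal I := ideal_pred I.

HB.instance Definition _ (A : comNzRingType) (I : set A) (hI : is_ideal I) :=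
  GRing.isSubmodClosed.Build A A^o (ideal_mem hI) (ideal_submod_closed hI).

Record ideal_module (A : comNzRingType) (I : set A) (hI : is_ideal I) :=
  IdealModule { ideal_val : A^o; _ : ideal_val \in ideal_mem hI }.

Section IdealModuleInstances.
Variables (A : comNzRingType) (I : set A) (hI : is_ideal I).
HB.instance Definition _ := [isSub for @ideal_val A I hI].
HB.instance Definition _ := [Choice of ideal_module hI by <:].
HB.instance Definition _ := [SubChoice_isSubLmodule of ideal_module hI by <:].
End IdealModuleInstances.

Section IdealInjective.
Variable A : comNzRingType.

(** A linear map from the ideal [I] is encoded as a total function on [A], unconstrained outside
    [I]. *)
Definition linear_on (V : lmodType A) (I : set A) (f : A -> V) : Prop :=
  (forall x y, I x -> I y -> f (x + y) = f x + f y) /\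
  (forall a x, I x -> f (a * x) = a *: f x).

(* [Ext^1(A/I, C) = 0] for every ideal [I]. *)
Definition ideal_injective (V : lmodType A) (C : V -> Prop) : Prop :=
  forall (I : set A) (f : A -> V), is_ideal I -> linear_on I f ->
    (forall x, I x -> C (f x)) -> exists2 c, C c & forall x, I x -> f x = x *: c.

Lemma injective_ideal_injective (V : lmodType A) :
  injective_module V -> ideal_injective (fun _ : V => True).
Proof.
move=> Vinj I f hI [fD fZ] _.
have mI (u : ideal_module hI) : I (val u) by have /asboolP := valP u.
pose g (u : ideal_module hI) : V := f (val u).
have g_lin : linear g.
  move=> a u v; rewrite /g linearP /= fD ?fZ //;
    by [exact: mI|exact: (idealMl a hI (mI u))].
pose gm := GRing.isLinear.Build _ _ _ _ g g_lin.
pose gl : {linear ideal_module hI -> V} := HB.pack g gm.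
have [h hh] := Vinj _ _ (val : {linear ideal_module hI -> A^o}) gl val_inj.
exists (h 1) => // x Ix; rewrite -linearZ /=.
have px : (x : A^o) \in ideal_mem hI by apply/asboolP.
by have /= := hh (IdealModule px); rewrite /g /= => <-; rewrite /GRing.scale /= mulr1.
Qed.

(** The coefficient [c] is chosen; two choices differ by an element carrying [x] into [J], which
    kills [v] by hypothesis. *)
Lemma quotient_map (V : lmodType A) (J : set A) x (v : V) : is_ideal J ->
  (forall c, J (c * x) -> c *: v = 0) ->
  exists f : A -> V, forall j c, J j -> f (j + c * x) = c *: v.
Proof.
move=> hJ hv.
pose f y : V := if pselect (exists c, J (y - c * x)) is left h then projT1 (cid h) *: v
  else 0.
exists f => j c Jj; rewrite /f; case: pselect => [h|[]]; last first.
  by exists c; rewrite addrK.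
case: (cid h) => d /= Jd; apply/eqP; rewrite -subr_eq0 -scalerBl; apply/eqP/hv.
have -> : (d - c) * x = j - (j + c * x - d * x) by ring.
exact: idealB.
Qed.

End IdealInjective.

(** * Self-injectivity of Artinian Gorenstein rings *)

Section SelfInjective.
Variables (A : comNzRingType) (m : set A).
Hypothesis mloc : local_ring m.
Variables (Z : nat -> set A) (h : nat).
Hypothesis hZ : loewy m Z h.

(** Take [x] outside [P] in the lowest possible term of the chain: its [m]-multiples lie one term
    lower. *)
Lemma loewy_step (P : A -> Prop) : (forall x, x = 0 -> P x) -> ~ P 1 ->
  exists x, ~ P x /\ forall a, m a -> P (a * x).
Proof.
case: hZ => Z0 Z1 ZS P0 nP1.
have ex : exists i, `[< exists2 x, Z i x & ~ P x >] by exists h; apply/asboolP; exists 1.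
case: (ex_minnP ex) => -[|i] /asboolP[x Zx nPx] mini.
  by case: nPx; apply: P0; apply: Z0.
exists x; split=> // a ma; apply: contrapT => nPax.
suff : (i.+1 <= i)%N by rewrite ltnn.
by apply: mini; apply/asboolP; exists (a * x) => //; apply: ZS.
Qed.

Lemma ex_socle_multiple (V : lmodType A) (v : V) : v != 0 ->
  exists a, a *: v != 0 /\ forall b, m b -> b *: (a *: v) = 0.
Proof.
move=> v0.
have [||a [na ha]] := @loewy_step (fun x => x *: v = 0).
- by move=> x ->; rewrite scale0r.
- by rewrite scale1r; apply/eqP.
exists a; split=> [|b mb]; first exact/eqP.
by rewrite scalerA; apply: ha.
Qed.

Lemma ex_socle : exists s : A, s != 0 /\ socle m s.
Proof.
by have [a [a0 ha]] := @ex_socle_multiple A^o 1 (oner_neq0 _); exists (a *: (1 : A^o)).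
Qed.

(** Dimension shifting alone would only give the vanishing of Ext^2. Here Ext^1 vanishes because
    socle elements of the image of [d] lift to socle elements of [V]; a map on an ideal then extends
    along one simple quotient at a time. *)
Lemma ker_ideal_injective (V W : lmodType A) (d : {linear V -> W}) :
  injective_module V -> ideal_injective (fun w => exists v, d v = w) ->
  ideal_injective (fun v => d v = 0).
Proof.
move=> Vinj Dinj.
have [sg [s0 ms]] := ex_socle.
(* The map sending the socle element [sg] to [w] is multiplication by some [d v1], so [sg *: v1] is
   a lift of [w] killed by [m]. *)
have lift_socle w : (forall a, m a -> a *: w = 0) -> (exists v, d v = w) ->
    exists2 v, d v = w & forall a, m a -> a *: v = 0.
  move=> mw [v0 dv0].
  have [c|f hf] := @quotient_map A W _ sg w (zero_ideal A).
    move=> /= csg; apply: mw; apply: contrapT => nmc.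
    have [y cy] := local_unit mloc nmc; case/eqP: s0.
    by rewrite -[sg]mul1r -cy mulrAC csg mul0r.
  have fE c : f (c * sg) = c *: w by rewrite -[c * sg]add0r hf.
  have [|||_ [v1 <-] hv1] := Dinj (adjoin [set 0] sg)%classic f.
  - exact/adjoin_ideal/zero_ideal.
  - split=> [_ _ [_ -> [a ->]] [_ -> [b ->]]|b _ [_ -> [a ->]]].
      by rewrite !add0r -mulrDl !fE scalerDl.
    by rewrite add0r mulrA !fE scalerA.
  - move=> _ [_ -> [a ->]]; rewrite add0r fE.
    by exists (a *: v0); rewrite linearZ /= dv0.
  exists (sg *: v1) => [|a ma]; last first.
    have e : a * sg = 0 := ms a ma.
    by rewrite scalerA e scale0r.
  rewrite linearZ /= -hv1; last exact/mem_adjoin/zero_ideal.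
  by rewrite -[sg]mul1r fE scale1r.
move=> I f hI flin fker.
pose P J := exists g : A -> V, [/\ linear_on J g, forall x, J x -> d (g x) = 0 &
  forall x, I x -> g x = f x].
have PI : P I by exists f; split.
have Anoeth : noetherian_ring A by case: mloc.
have [J [hJ [g [glin gker gf]] sIJ maxJ]] := noetherian_max Anoeth hI PI.
case: (pselect (J 1)) => [J1|nJ1].
  exists (g 1); first exact: gker.
  by move=> x Ix; rewrite -gf // -[in LHS](mulr1 x) glin.2.
have [|x [nJx mx]] := loewy_step (P := J) _ nJ1.
  by move=> x ->; apply: ideal0.
(* On [J], [g] is multiplication by [e], but [x *: e] may leave the kernel of [d]. Its image is
   killed by [m], so a socle element [v] has the same image; [th] subtracts this correction and
   vanishes on [J]. *)
have [e _ he] := injective_ideal_injective Vinj hJ glin (fun _ _ => Logic.I).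
have [||v dv mv] := lift_socle (d (x *: e)).
- by move=> a ma; rewrite -linearZ /= scalerA -he ?gker //; apply: mx.
- by exists (x *: e).
have mJ c : J (c * x) -> m c.
  move=> Jcx; apply: contrapT => nmc; have [y cy] := local_unit mloc nmc.
  by apply: nJx; rewrite -[x]mul1r -cy mulrAC; apply: idealMr.
have [|th hth] := @quotient_map A V J x v hJ; first by move=> c /mJ /mv.
have hth0 y : J y -> th y = 0.
  by move=> Jy; rewrite -[y]addr0 -(mul0r x) hth // scale0r.
suff eJ : adjoin J x = J by case: nJx; rewrite -eJ; apply: mem_adjoin.
apply: maxJ; [exact: adjoin_ideal| |exact: sub_adjoin].
exists (fun y => y *: e - th y); split.
- split=> [_ _ [i Ji [a ->]] [j Jj [b ->]]|b _ [i Ji [a ->]]].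
    have -> : i + a * x + (j + b * x) = i + j + (a + b) * x by ring.
    rewrite !hth //; last exact: idealD.
    rewrite addrACA -opprD -!scalerDl; congr (_ *: _ - _); ring.
  have -> : b * (i + a * x) = b * i + (b * a) * x by ring.
  rewrite !hth //; last exact: idealMl.
  by rewrite scalerBr !scalerA; congr (_ *: _ - _); ring.
- move=> _ [i Ji [a ->]]; rewrite hth // scalerDl -scalerA linearB linearD.
  by rewrite [d (a *: v)]linearZ [d (a *: _)]linearZ /= dv addrK -he // gker.
- by move=> y Iy; rewrite -gf // hth0 ?subr0 ?he //; apply: sIJ.
Qed.

(** Descend along the injective resolution from degree [n.+1], where the module is zero, to the
    kernel in degree 0, which is [A] itself. *)
Lemma gorenstein_self_injective : gorenstein_ring A ->
  forall (I : set A) (f : A -> A), is_ideal I -> linear_on (V := A^o) I f ->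
  exists r, forall x, I x -> f x = x * r.
Proof.
move=> [E [n En]] I f hI flin.
have ker_inj k : (k <= n.+1)%N ->
    ideal_injective (fun v : ir_mod E (n.+1 - k) => ir_diff E _ v = 0).
  elim: k => [|k IH] hk.
    rewrite subn0 => J g hJ glin _; exists 0; first exact: linear0.
    by move=> x _; rewrite scaler0; apply: En.
  have {IH} := IH (ltnW hk); rewrite subSn // => IH.
  rewrite subSS; apply: ker_ideal_injective; first exact: ir_injective.
  move=> J g hJ glin gim; have [|c hc ?] := IH J g hJ glin.
    by move=> x /gim; apply: (ir_exact _).2.
  by exists c => //; apply/(ir_exact _).1.
have := ker_inj n.+1 (leqnn _); rewrite subnn => K0.
have [||c] := K0 I (fun x => ir_aug E (f x)) hI.
- split=> [x y Ix Iy|a x Ix]; first by rewrite flin.1 // linearD.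
  by rewrite flin.2 // linearZ.
- by move=> x _; apply/(ir_exact0 _).2; exists (f x).
move=> /(ir_exact0 _).1 [r <-] hr; exists r => x Ix.
by apply: (@ir_aug_inj _ _ E); rewrite hr // -linearZ.
Qed.

Definition second_socle : set A := [set r | forall a, m a -> socle m (a * r)]%classic.
Definition second_socle_ann : set A := [set c | forall r, second_socle r -> r * c = 0]%classic.

Lemma second_socle_ann_ideal : is_ideal second_socle_ann.
Proof.
split=> /= [r _|x y hx hy r hr|a x hx r hr]; first by rewrite mulr0.
  by rewrite mulrDr hx // hy // addr0.
by rewrite mulrCA hx // mulr0.
Qed.

(** Otherwise take [I] maximal among the ideals strictly inside [m] containing [a]. Since [m/I] is
    simple, some map from [m] to the socle kills [I] but not [b]. It is multiplication by an [r] in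
    [second_socle], which kills both [a] and [second_socle_ann], hence [b]. *)
Lemma gorenstein_principal a : gorenstein_ring A -> m a ->
  (forall b, m b -> adjoin second_socle_ann a b) ->
  forall b, m b -> exists c, b = c * a.
Proof.
move=> Agor ma hma b0 mb0; apply: contrapT => nb0.
have hm := local_ideal mloc.
pose P I := (I `<=` m)%classic /\ exists b, m b /\ ~ I b.
have Anoeth : noetherian_ring A by case: mloc.
pose I0 := adjoin [set 0]%classic a.
have [||I [hI [sIm [b [mb nIb]]] sI0 maxI]] := @noetherian_max A Anoeth P I0.
- exact/adjoin_ideal/zero_ideal.
- split=> [_ [_ -> [c ->]]|]; first by rewrite add0r; apply: idealMl.
  by exists b0; split=> // -[_ -> [c e]]; apply: nb0; exists c; rewrite e add0r.
have full c : m c -> ~ I c -> (m `<=` adjoin I c)%classic.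
  move=> mc nIc x mx; apply: contrapT => nx; apply: nIc.
  rewrite -(maxI (adjoin I c)); [exact: mem_adjoin|exact: adjoin_ideal| |exact: sub_adjoin].
  split; last by exists x.
  by move=> _ [i /sIm mi [d ->]]; apply: idealD => //; apply: idealMl.
have Ib c : m c -> I (c * b).
  move=> mc; apply: contrapT => nIcb.
  have [i Ii [d e]] := full _ (idealMl c hm mb) nIcb _ mb.
  have [|y hy] := @local_unit _ _ mloc (1 - d * c).
    move=> m1; case: mloc => _ [_ nm1 _] _; apply: nm1.
    by rewrite -[1](subrK (d * c)); apply: idealD => //; apply: idealMl.
  apply: nIb; rewrite -[b]mul1r -hy mulrAC mulrBl mul1r.
  by apply: idealMr => //; rewrite -mulrA {1}e addrK.
have mI c : I (c * b) -> m c.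
  move=> Icb; apply: contrapT => nmc; have [y cy] := local_unit mloc nmc.
  by apply: nIb; rewrite -[b]mul1r -cy mulrAC; apply: idealMr.
have [sg [s0 ms]] := ex_socle.
have [|f hf] := @quotient_map A A^o I b sg hI; first by move=> c /mI /ms.
have [|r hr] := gorenstein_self_injective Agor (I := m) (f := f) hm.
  split=> [x y mx my|c x mx].
    have [i Ii [d ->]] := full b mb nIb _ mx; have [j Ij [e ->]] := full b mb nIb _ my.
    have -> : i + d * b + (j + e * b) = i + j + (d + e) * b by ring.
    by rewrite !hf //; [rewrite scalerDl|exact: idealD].
  have [i Ii [d ->]] := full b mb nIb _ mx.
  have -> : c * (i + d * b) = c * i + (c * d) * b by ring.
  by rewrite !hf //; [rewrite scalerA|exact: idealMl].
have Ir i : I i -> i * r = 0.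
  move=> Ii; rewrite -hr; last exact: sIm.
  by have := hf i 0 Ii; rewrite mul0r addr0 scale0r.
have r2 : second_socle r.
  move=> c mc d md; rewrite -hr //.
  have [i Ii [e ->]] := full b mb nIb _ mc.
  rewrite hf //; have <- := ms (d * e) (idealMr e hm md).
  by rewrite -mulrA.
have [j hj [c e]] := hma b mb; case/eqP: s0.
have <- : f b = sg by rewrite -[b]add0r -[X in 0 + X]mul1r hf ?scale1r //; exact: ideal0.
rewrite hr // e mulrDl (mulrC j) hj // -mulrA Ir ?mulr0 ?addr0 //.
by apply: sI0; apply/mem_adjoin/zero_ideal.
Qed.

End SelfInjective.

(** * Minimal resolutions *)

Section Generators.
Variables (A : comNzRingType) (V : lmodType A).

Fixpoint span_seq (s : seq V) (x : V) : Prop :=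
  if s is v :: s' then exists a y, span_seq s' y /\ x = a *: v + y else x = 0.

Lemma span_seq_cat s t x y : span_seq s x -> span_seq t y -> span_seq (s ++ t) (x + y).
Proof.
elim: s x => [x -> ty|v s IH _ [a [z [hz ->]]] ty] /=; first by rewrite add0r.
by exists a, (z + y); rewrite addrA; split=> //; apply: IH.
Qed.

Lemma span_seq0 s : span_seq s 0.
Proof.
by elim: s => //= v s IH; exists 0, 0; rewrite scale0r addr0.
Qed.

Lemma span_seq_mem s v : List.In v s -> span_seq s v.
Proof.
elim: s => //= w s IH [->|/IH hv].
  by exists 1, 0; rewrite scale1r addr0; split=> //; apply: span_seq0.
by exists 0, v; rewrite scale0r add0r.
Qed.

Lemma span_seqP s x :
  span_seq s x <-> exists a : 'I_(size s) -> A, x = \sum_(i < size s) a i *: nth 0 s i.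
Proof.
elim: s x => [|v s IH] x /=.
  by split=> [->|[a ->]]; [exists (fun _ => 0); rewrite big_ord0|rewrite big_ord0].
split=> [[a [y [/IH [b ->] ->]]]|[a ->]].
  exists (fun i => if unlift ord0 i is Some j then b j else a).
  rewrite big_ord_recl unlift_none /=; congr (_ + _).
  by apply: eq_bigr => i _; rewrite liftK.
exists (a ord0), (\sum_(i < size s) a (lift ord0 i) *: nth 0 s i).
by split; [apply/IH; exists (fun i => a (lift ord0 i))|rewrite big_ord_recl].
Qed.

Definition span (n : nat) (g : 'I_n -> V) (x : V) : Prop :=
  exists a : 'I_n -> A, x = \sum_(i < n) a i *: g i.

Lemma span_trans n (g : 'I_n -> V) p (g' : 'I_p -> V) x :
  span g x -> (forall i, span g' (g i)) -> span g' x.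
Proof.
move=> [a ->] /choice [b hb]; exists (fun j => \sum_i a i * b i j).
under eq_bigr => i _ do rewrite hb scaler_sumr.
rewrite exchange_big; apply: eq_bigr => j _ /=; rewrite scaler_suml.
by apply: eq_bigr => i _; rewrite scalerA.
Qed.

Lemma span_gen n (g : 'I_n -> V) i : span g (g i).
Proof.
exists (fun j => (j == i)%:R); rewrite (bigD1 i) //= eqxx scale1r big1 ?addr0 //.
by move=> j /negbTE ->; rewrite scale0r.
Qed.

End Generators.

Section MinimalGenerators.
Variables (S : comNzRingType) (n : set S).
Hypotheses (n_unit : forall x, ~ n x -> exists y, x * y = 1).

(** In a generating family of least size, a relation with a unit coefficient would make one
    generator redundant. *)
Lemma minimal_generators (V : lmodType S) (K : V -> Prop) p (g : 'I_p -> V) :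
  (forall x, K x <-> span g x) ->
  exists c (g' : 'I_c -> V), (forall x, K x <-> span g' x) /\
    forall a : 'I_c -> S, \sum_(i < c) a i *: g' i = 0 -> forall i, n (a i).
Proof.
move=> Kg.
have ex : exists c, `[< exists g' : 'I_c -> V, forall x, K x <-> span g' x >].
  by exists p; apply/asboolP; exists g.
case: (ex_minnP ex) => c /asboolP[g' Kg'] minc; exists c, g'; split=> // a ha i.
apply: contrapT => /n_unit [y ay].
case: c => [|c] in g' Kg' minc a ha i ay *; first by case: i {ay}.
suff : (c.+1 <= c)%N by rewrite ltnn.
apply: minc; apply/asboolP; exists (fun j => g' (lift i j)) => x; rewrite Kg'.
split=> hx; apply: span_trans hx _ => j; last exact: span_gen.
case: (unliftP i j) => [k ->|->]; first exact: (span_gen (fun j => g' (lift i j))).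
exists (fun k => - (y * a (lift i k))).
have /(congr1 (fun v => y *: v)) := ha.
rewrite (bigD1_ord i) //= scaler0 scalerDr scalerA mulrC ay scale1r => /eqP.
rewrite addr_eq0 => /eqP ->; rewrite scaler_sumr -sumrN.
by apply: eq_bigr => k _; rewrite scalerA scaleNr.
Qed.

Hypothesis Snoeth : noetherian_ring S.

Lemma ideal_fg (I : set S) : is_ideal I ->
  exists s : seq S^o, forall x, I x <-> span_seq s x.
Proof.
move=> hI.
pose P J := (J `<=` I)%classic /\ exists s : seq S^o, forall x, J x <-> span_seq s x.
have P0 : P [set 0]%classic.
  by split=> [x ->|]; [exact: ideal0|exists [::]].
have [J [hJ [sJI [s Js]] _ maxJ]] := noetherian_max Snoeth (zero_ideal S) P0.
exists s => x; split=> [Ix|/Js /sJI//]; apply/Js; rewrite -(maxJ (adjoin J x)).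
- exact: mem_adjoin.
- exact: adjoin_ideal.
- split=> [_ [j Jj [a ->]]|]; first by apply: idealD => //; [exact: sJI|exact: idealMl].
  exists (x :: s) => y /=; split=> [[j /Js Jj [a ->]]|[a [j [/Js Jj ->]]]].
    by exists a, j; rewrite addrC.
  by exists j => //; exists a; rewrite addrC.
- exact: sub_adjoin.
Qed.

Definition submodule (V : lmodType S) (K : V -> Prop) : Prop :=
  [/\ K 0, forall x y, K x -> K y -> K (x + y) & forall a x, K x -> K (a *: x)].

Lemma submodule_sum (V : lmodType S) (K : V -> Prop) s x :
  submodule K -> (forall v, List.In v s -> K v) -> span_seq s x -> K x.
Proof.
move=> [K0 KD KZ]; elim: s x => [x _ ->//|v s IH _ hs [a [y [hy ->]]]].
apply: KD; first by apply: KZ; apply: hs; left.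
by apply: IH => // w hw; apply: hs; right.
Qed.

(** Induction on the number [k] of coordinates allowed to be nonzero. The last of these coordinates
    takes its values in a finitely generated ideal; lifting its generators reduces to the rows where
    it vanishes. *)
Lemma row_submodule_fg p (K : 'rV[S]_p -> Prop) : submodule K ->
  exists s : seq 'rV[S]_p, forall x, K x <-> span_seq s x.
Proof.
move=> hK.
suff H k : (k <= p)%N -> forall K : 'rV[S]_p -> Prop, submodule K ->
    (forall x (i : 'I_p), K x -> (k <= i)%N -> x 0 i = 0) ->
    exists s : seq 'rV[S]_p, forall x, K x <-> span_seq s x.
  by apply: (H p) => // x i _; rewrite leqNgt ltn_ord.
elim: k => [|k IH] kp {}K {}hK Kk; have [K0 KD KZ] := hK.
  exists [::] => x; split=> [Kx|->//]; apply/rowP => i.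
  by rewrite mxE Kk.
pose ik := Ordinal kp.
pose I : set S := [set r | exists2 x, K x & x 0 ik = r]%classic.
have hI : is_ideal I.
  split=> [|_ _ [x Kx <-] [y Ky <-]|a _ [x Kx <-]].
  - by exists 0 => //; rewrite mxE.
  - by exists (x + y); rewrite ?mxE //; apply: KD.
  - by exists (a *: x); rewrite ?mxE //; apply: KZ.
have [s Is] := ideal_fg hI.
have [lft hlft] : exists f : S -> 'rV[S]_p, forall r, I r -> K (f r) /\ f r 0 ik = r.
  suff /choice [f hf] : forall r, exists x, I r -> K x /\ x 0 ik = r by exists f.
  move=> r; case: (pselect (I r)) => [[x Kx <-]|nI]; first by exists x.
  by exists 0 => /nI.
pose K' x := K x /\ x 0 ik = 0.
have [||t K't] := IH (ltnW kp) K'.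
- split=> [|x y [Kx x0] [Ky y0]|a x [Kx x0]].
  + by split=> //; rewrite mxE.
  + by split; [exact: KD|rewrite mxE x0 y0 addr0].
  + by split; [exact: KZ|rewrite mxE x0 mulr0].
- move=> x i [Kx x0]; rewrite leq_eqVlt => /orP[/eqP ki|/Kk]; last exact.
  by rewrite -x0; congr (x _ _); apply: val_inj.
have sI : forall r, List.In r s -> I r.
  by move=> r hr; apply/Is/span_seq_mem.
exists ([seq lft r | r <- s] ++ t) => x; split=> [Kx|].
  have [w [sw wk Kw]] : exists w, [/\ span_seq [seq lft r | r <- s] w,
      w 0 ik = x 0 ik & K w].
    have /Is : I (x 0 ik) by exists x.
    elim: s sI {Is} (x 0 ik) => [|v s IHs] sI r /=; first by exists 0; rewrite mxE.
    move=> [a [y [hy ->]]]; have [|w [hw wk Kw]] := IHs _ y hy.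
      by move=> u hu; apply: sI; right.
    have [Kv vk] := hlft v (sI v (or_introl erefl)).
    exists (a *: lft v + w); split; [by exists a, w|by rewrite !mxE vk wk|].
    by apply: KD => //; apply: KZ.
  rewrite -[x](subrK w) [_ + w]addrC; apply: span_seq_cat => //; apply/K't; split.
    by rewrite -scaleN1r; apply: KD => //; apply: KZ.
  by rewrite !mxE wk subrr.
apply: submodule_sum => // v; rewrite List.in_app_iff => -[|vt].
  elim: s sI {Is} => //= r s IHs sI [<-|]; last by apply: IHs => u hu; apply: sI; right.
  by have [] := hlft r (sI r (or_introl erefl)).
suff [] : K' v by [].
exact/K't/span_seq_mem.
Qed.

Definition row_span (c p : nat) (D : 'M[S]_(c, p)) (x : 'rV[S]_p) : Prop :=
  exists z : 'rV[S]_c, x = z *m D.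

Lemma row_submodule_matrix p (K : 'rV[S]_p -> Prop) : submodule K ->
  exists c (D : 'M[S]_(c, p)), (forall x, K x <-> row_span D x) /\
    forall z : 'rV[S]_c, z *m D = 0 -> forall j, n (z 0 j).
Proof.
move=> hK; have [s Ks] := row_submodule_fg hK.
have [|c [g [Kg gmin]]] := @minimal_generators _ K (size s) (fun i => nth 0 s i).
  by move=> x; rewrite Ks span_seqP.
have DE (z : 'rV[S]_c) : z *m (\matrix_(i < c) g i) = \sum_i z 0 i *: g i.
  by rewrite mulmx_sum_row; apply: eq_bigr => i _; rewrite rowK.
exists c, (\matrix_(i < c) g i); split=> [x|z]; last by rewrite DE; apply: gmin.
rewrite Kg; split=> [[a ->]|[z ->]]; last by exists (z 0); rewrite DE.
by exists (\row_i a i); rewrite DE; apply: eq_bigr => i _; rewrite mxE.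
Qed.

Definition exact_at (c p q : nat) (D' : 'M[S]_(q, c)) (D : 'M[S]_(c, p)) : Prop :=
  forall x : 'rV[S]_c, x *m D = 0 <-> row_span D' x.

Definition entries_in (I : set S) (c p : nat) (D : 'M[S]_(c, p)) : Prop :=
  forall i j, I (D i j).

Lemma minimal_resolution (M : lmodType S) : finitely_generated M ->
  exists (b : nat -> nat) (D : forall i, 'M[S]_(b i.+1, b i)) (g : 'I_(b 0) -> M),
    [/\ forall x, exists a : 'rV[S]_(b 0), x = \sum_i a 0 i *: g i,
        forall a : 'rV[S]_(b 0), \sum_i a 0 i *: g i = 0 <-> row_span (D 0%N) a,
        forall i, exact_at (D i.+1) (D i) & forall i, entries_in n (D i)].
Proof.
move=> [p [g0 hg0]].
have [|b0 [g [hg gmin]]] := @minimal_generators M (fun _ => True) p g0.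
  by move=> x; split=> // _; apply: hg0.
have [|b1 [D0 [hD0 D0min]]] :=
    @row_submodule_matrix b0 (fun a => \sum_i a 0 i *: g i = 0).
  split=> [|x y x0 y0|a x x0].
  - by apply: big1 => i _; rewrite mxE scale0r.
  - under eq_bigr => i _ do rewrite mxE scalerDl.
    by rewrite big_split /= x0 y0 addr0.
  - under eq_bigr => i _ do rewrite mxE -scalerA.
    by rewrite -scaler_sumr x0 scaler0.
(* The recursion carries a matrix whose row relations have coefficients in [n]. The rows of the next
   matrix are such relations, whence minimality. *)
pose T := {b : nat & {c : nat & {D : 'M[S]_(c, b) |
  forall z : 'rV[S]_c, z *m D = 0 -> forall j, n (z 0 j)}}}.
have step (c b : nat) (D : 'M[S]_(c, b)) : {c' : nat & {D' : 'M[S]_(c', c) |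
    exact_at D' D /\ forall z : 'rV[S]_c', z *m D' = 0 -> forall j, n (z 0 j)}}.
  have hK : submodule (fun x : 'rV[S]_c => x *m D = 0).
    split=> [|x y x0 y0|a x x0]; first by rewrite mul0mx.
      by rewrite mulmxDl x0 y0 addr0.
    by rewrite -scalemxAl x0 scaler0.
  by have [c' /cid[D' hD']] := cid (row_submodule_matrix hK); exists c', D'.
pose next (t : T) : T :=
  let s := step _ _ (sval (projT2 (projT2 t))) in
  existT _ (projT1 (projT2 t)) (existT _ (projT1 s)
    (exist _ (sval (projT2 s)) (svalP (projT2 s)).2)).
pose st i : T := iter i next (existT _ b0 (existT _ b1 (exist _ D0 D0min))).
exists (fun i => projT1 (st i)), (fun i => sval (projT2 (projT2 (st i)))), g.
have ex i : exact_at (sval (projT2 (projT2 (st i.+1)))) (sval (projT2 (projT2 (st i)))).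
  exact: (svalP (projT2 (step _ _ (sval (projT2 (projT2 (st i))))))).1.
split=> //= [x|i].
  have [a ->] := (hg x).1 Logic.I.
  by exists (\row_i a i); apply: eq_bigr => i _; rewrite mxE.
have rowE c q (D : 'M[S]_(c, q)) j : row_span D (row j D).
  by exists (delta_mx 0 j); rewrite rowE.
case: i => [|i] j k; last first.
  have h0 := (ex i _).2 (rowE _ _ _ j).
  by have := svalP (projT2 (projT2 (st i))) _ h0 k; rewrite mxE.
have h0 := (hD0 _).2 (rowE _ _ D0 j).
by have := gmin _ h0 k; rewrite mxE.
Qed.

End MinimalGenerators.

(** * Tor over a resolution by free modules *)

Section FreeResolution.
Variable S : comNzRingType.

Definition row_comb (p : nat) (V : lmodType S) (g : 'I_p -> V) (x : 'rV[S]_p) : V :=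
  \sum_i x 0 i *: g i.

Lemma row_comb_linear p (V : lmodType S) (g : 'I_p -> V) : linear (@row_comb p V g).
Proof.
move=> a x y; rewrite /row_comb scaler_sumr -big_split /=.
by apply: eq_bigr => i _; rewrite !mxE scalerDl scalerA.
Qed.

HB.instance Definition _ p (V : lmodType S) (g : 'I_p -> V) :=
  GRing.isLinear.Build _ _ _ _ (row_comb g) (row_comb_linear g).

Lemma row_comb_delta p (V W : lmodType S) (f : {linear 'rV[S]_p -> W}) x :
  f x = row_comb (fun i => f (delta_mx 0 i)) x.
Proof.
by rewrite {1}(row_sum_delta x) linear_sum; apply: eq_bigr => i _; rewrite linearZ.
Qed.

Lemma row_projective p : projective_module 'rV[S]_p.
Proof.
move=> V W g f gsurj.
have /choice [l hl] : forall i : 'I_p, exists a, g a = f (delta_mx 0 i).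
  by move=> i; apply: gsurj.
exists (row_comb l) => x; rewrite (row_comb_delta V f) linear_sum.
by apply: eq_bigr => i _; rewrite linearZ /= hl.
Qed.

Definition row_coord (p : nat) (N : lmodType S) (k : 'I_p) (x : 'rV[S]_p) (y : N) : N :=
  x 0 k *: y.

Lemma row_coord_bilinear p (N : lmodType S) k : bilinear_for
  (GRing.Scale.Law.clone _ _ *:%R _) (GRing.Scale.Law.clone _ _ *:%R _)
  (@row_coord p N k).
Proof.
split=> [y|x] a u v /=; rewrite /row_coord.
  by rewrite !mxE scalerDl scalerA.
by rewrite scalerDr !scalerA mulrC.
Qed.

HB.instance Definition _ p (N : lmodType S) k :=
  bilinear_isBilinear.Build S 'rV[S]_p N N _ _ (@row_coord p N k)
    (row_coord_bilinear N k).

(** The tensor product of [S^p] with [N] is [N^p]: every bilinear map factors through the maps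
    [row_coord]. *)
Lemma row_tensor_eqP p (N : lmodType S) (s t : seq ('rV[S]_p * N)) :
  tensor_eq s t <-> forall k, \sum_(q <- s) q.1 0 k *: q.2 = \sum_(q <- t) q.1 0 k *: q.2.
Proof.
split=> [st k|st W f]; first exact: (st N (@row_coord p N k)).
have fE (u : seq ('rV[S]_p * N)) :
    \sum_(q <- u) f q.1 q.2 = \sum_k f (delta_mx 0 k) (\sum_(q <- u) q.1 0 k *: q.2).
  under [RHS]eq_bigr => k _ do rewrite linear_sumr.
  rewrite exchange_big /=; apply: eq_bigr => q _.
  rewrite {1}(row_sum_delta q.1) linear_sumlz; apply: eq_bigr => k _.
  by rewrite linearZl_LR linearZr_LR.
by rewrite !fE; apply: eq_bigr => k _; rewrite st.
Qed.

Section Resolution.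
Variables (M : lmodType S) (b : nat -> nat) (D : forall i, 'M[S]_(b i.+1, b i)).
Variable g : 'I_(b 0) -> M.
Hypotheses (g_surj : forall x, exists a : 'rV[S]_(b 0), x = \sum_i a 0 i *: g i)
  (g_exact : forall a : 'rV[S]_(b 0), \sum_i a 0 i *: g i = 0 <-> row_span (D 0%N) a)
  (D_exact : forall i, exact_at (D i.+1) (D i)).

Definition matrix_resolution : proj_resolution M.
Proof.
refine (@ProjResolution S M (fun i => 'rV[S]_(b i)) (fun i => mulmxr (D i))
  (row_comb g) _ _ _ _).
- by move=> i; apply: row_projective.
- by move=> x; have [a ->] := g_surj x; exists a.
- move=> y; split=> [/g_exact [z ->]|[z <-]]; first by exists z.
  by apply/g_exact; exists z.
- move=> i y; split=> [/D_exact [z ->]|[z <-]]; first by exists z.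
  by apply/D_exact; exists z.
Defined.

Lemma tor_exact (N : lmodType S) i (z : seq ('rV[S]_(b i.+1) * N)) :
  tor_eq0 i.+1 M N ->
  (forall j, \sum_(q <- z) (q.1 *m D i) 0 j *: q.2 = 0) ->
  exists w : seq ('rV[S]_(b i.+2) * N), forall k,
    \sum_(q <- w) (q.1 *m D i.+1) 0 k *: q.2 = \sum_(q <- z) q.1 0 k *: q.2.
Proof.
move=> tor0 hz; have [|w hw] := tor0 matrix_resolution z.
  rewrite /tensor_cycle /=; apply/row_tensor_eqP => k.
  by rewrite big_map big_nil; apply: hz.
exists w => k; have /row_tensor_eqP /(_ k) <- := hw.
by rewrite big_map.
Qed.

End Resolution.

Lemma free_finite_projective_dimension (M : lmodType S) p (g : 'I_p -> M) :
  (forall x, exists a : 'rV[S]_p, x = \sum_i a 0 i *: g i) ->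
  (forall a : 'rV[S]_p, \sum_i a 0 i *: g i = 0 -> a = 0) ->
  finite_projective_dimension M.
Proof.
move=> gsurj gfree.
pose b i := if i is _.+1 then 0%N else p.
pose D i : 'M[S]_(b i.+1, b i) := 0.
have g_exact (a : 'rV[S]_(b 0%N)) : \sum_i a 0 i *: g i = 0 <-> row_span (D 0%N) a.
  split=> [/gfree ->|[z ->]]; first by exists 0; rewrite mul0mx.
  by rewrite mulmx0 big1 // => i _; rewrite mxE scale0r.
have D_exact i : exact_at (D i.+1) (D i).
  move=> x; split=> _; last by rewrite mulmx0.
  by exists 0; apply/rowP => -[].
exists (matrix_resolution gsurj g_exact D_exact), 0%N => -[//|i] _ x.
by apply/rowP => -[].
Qed.

End FreeResolution.

(** * Freeness of [N] from a socle element in a syzygy *)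

Section SocleColumn.
Variables (S : comNzRingType) (n : set S).
Hypotheses (n_ideal : is_ideal n) (Snoeth : noetherian_ring S).
Variables (Z : nat -> set S) (h : nat).
Hypothesis hZ : loewy n Z h.

(** Nakayama's lemma by induction along the chain: every term kills [K], and the last one contains
    1. *)
Lemma loewy_nakayama (V : lmodType S) (K : V -> Prop) :
  (forall x, K x -> exists p (t : 'I_p -> S) (y : 'I_p -> V),
     [/\ forall l, n (t l), forall l, K (y l) & x = \sum_l t l *: y l]) ->
  forall x, K x -> x = 0.
Proof.
case: hZ => Z0 Z1 ZS hK x Kx.
suff /(_ h _ Z1 x Kx) : forall i a, Z i a -> forall x, K x -> a *: x = 0.
  by rewrite scale1r.
elim=> [a /Z0 -> y _|i IH a Za y /hK [p [t [w [nt Kw ->]]]]]; first by rewrite scale0r.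
rewrite scaler_sumr; apply: big1 => l _; rewrite scalerA mulrC.
by apply: IH => //; apply: ZS.
Qed.

Lemma ideal_generators (I : set S) : is_ideal I ->
  exists p (t : 'cV[S]_p), forall q (x : 'cV[S]_q), entries_in I x <->
    exists a : 'M[S]_(q, p), x = a *m t.
Proof.
move=> hI; have [s Is] := ideal_fg Snoeth hI.
exists (size s), (\col_i nth 0 s i) => q x; split=> [Ix|[a ->] i j].
  have /choice [a ha] i : exists a : 'I_(size s) -> S, x i 0 = \sum_l a l * nth 0 s l.
    exact/(span_seqP (V := S^o))/Is.
  exists (\matrix_(i, l) a i l); apply/matrixP => i j; rewrite ord1 ha !mxE.
  by apply: eq_bigr => l _; rewrite !mxE.
apply/Is/span_seqP; exists (a i); rewrite !mxE; apply: eq_bigr => l _.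
by rewrite !mxE.
Qed.

(* Since [e *m D0] lies in the socle, [e] spans a copy of the residue field [k] in
   the cokernel of [D1], and exactness after tensoring with [N] yields
   [Tor_1(k, N) = 0]. *)
Lemma socle_column_free (N : lmodType S) c (g : 'I_c -> N) c0 c1 c2 c3
    (D0 : 'M[S]_(c1, c0)) (D1 : 'M[S]_(c2, c1)) (D2 : 'M[S]_(c3, c2))
    (e : 'rV[S]_c1) (q : 'I_c1) :
  (forall y, exists a : 'rV[S]_c, y = \sum_i a 0 i *: g i) ->
  (forall a : 'I_c -> S, \sum_i a i *: g i = 0 -> forall i, n (a i)) ->
  exact_at D1 D0 -> exact_at D2 D1 -> entries_in n D1 ->
  e 0 q = 1 -> (forall a, n a -> a *: (e *m D0) = 0) ->
  (forall z : seq ('rV[S]_c2 * N),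
    (forall j, \sum_(p <- z) (p.1 *m D1) 0 j *: p.2 = 0) ->
    exists w : seq ('rV[S]_c3 * N), forall k,
      \sum_(p <- w) (p.1 *m D2) 0 k *: p.2 = \sum_(p <- z) p.1 0 k *: p.2) ->
  forall a : 'rV[S]_c, \sum_i a 0 i *: g i = 0 -> a = 0.
Proof.
move=> gsurj gmin ex1 ex2 nD1 eq1 socD0 torex.
have [L [t nt]] := ideal_generators n_ideal.
have nt1 : entries_in n t by apply/nt; exists 1%:M; rewrite mul1mx.
have /choice [nu hnu] y : exists a, y = row_comb g a by apply: gsurj.
have /nt [Th hTh] : entries_in n (col q D1) by move=> i j; rewrite mxE.
have /choice [G hG] : forall l, exists f : 'rV[S]_c2, t l 0 *: e = f *m D1.
  by move=> l; apply/ex1; rewrite -scalemxAl socD0.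
(* Compare coordinates [q] in [t l 0 *: e = G l *m D1]: [e] has entry 1 there, and column [q] of
   [D1] is [Th *m t]. *)
have GTh : (\matrix_l G l) *m Th *m t = t.
  apply/colP => l; rewrite -mulmxA -hTh -[LHS]mulr1.
  have -> : ((\matrix_l G l) *m col q D1) l 0 = (G l *m D1) 0 q.
    by rewrite !mxE; apply: eq_bigr => k _; rewrite !mxE.
  by rewrite -hG mxE eq1 !mulr1.
(* It remains to write each relation [x] between the generators of [N] as an [n]-combination of
   relations. *)
apply: loewy_nakayama => x Kx.
have /nt [U hU] : entries_in n x^T.
  by move=> i j; rewrite mxE ord1; apply: (gmin (x 0)).
pose u l : 'rV[S]_c := (col l U)^T; pose y l := row_comb g (u l).
have xE : x = \sum_l t l 0 *: u l.
  apply/rowP => i; have -> : x 0 i = x^T i 0 by rewrite mxE.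
  rewrite hU mxE summxE; apply: eq_bigr => l _.
  by rewrite !mxE mulrC.
have ty0 : \sum_l t l 0 *: y l = 0.
  transitivity (row_comb g x); last exact: Kx.
  by rewrite {1}xE linear_sum; apply: eq_bigr => l _; rewrite linearZ.
(* [D1] sends this chain to the tensor of [e] with the sum of the [t l 0 *: y l], which is zero. *)
have [|w hw] := torex [seq (G l, y l) | l <- enum 'I_L].
  move=> j; rewrite big_map big_enum /=.
  under eq_bigr => l _ do rewrite -hG mxE mulrC -scalerA.
  by rewrite -scaler_sumr ty0 scaler0.
pose H := (\matrix_l G l) *m Th.
have hwl l : \sum_(p <- w) (p.1 *m D2 *m Th) 0 l *: p.2 = \sum_l' H l' l *: y l'.
  under eq_bigr => p _ do rewrite mxE scaler_suml.
  rewrite exchange_big /=.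
  under eq_bigr => k _.
    under eq_bigr => p _ do rewrite mulrC -scalerA.
    rewrite -scaler_sumr hw big_map big_enum /= scaler_sumr.
    over.
  rewrite exchange_big; apply: eq_bigr => l' _ /=.
  rewrite !mxE scaler_suml; apply: eq_bigr => k _.
  by rewrite mxE scalerA mulrC.
(* Applying [Th] to [hw] expresses one element of [N] in two ways, and the difference is a relation.
   Weighted by [t], the first parts sum to [x] as [H *m t = t], the second to 0 as
   [D2 *m D1 = 0]. *)
exists L, (fun l => t l 0), (fun l => \sum_l' H l' l *: u l'
  - \sum_(p <- w) (p.1 *m D2 *m Th) 0 l *: nu p.2).
split=> [l|l|]; first exact: nt1.
  transitivity (row_comb g (\sum_l' H l' l *: u l') -
    row_comb g (\sum_(p <- w) (p.1 *m D2 *m Th) 0 l *: nu p.2)).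
    by rewrite -linearB.
  rewrite [X in X - _]linear_sum [X in _ - X]linear_sum.
  apply/eqP; rewrite subr_eq0; apply/eqP.
  under [RHS]eq_bigr => p _ do rewrite linearZ /= -hnu.
  by rewrite hwl; apply: eq_bigr => l' _; rewrite linearZ.
under eq_bigr => l _ do rewrite scalerBr !scaler_sumr.
rewrite sumrB [X in _ - X]exchange_big /= [X in _ - X]big1 ?subr0 => [|p _].
  rewrite {1}xE exchange_big; apply: eq_bigr => l' _ /=.
  under eq_bigr => l _ do rewrite scalerA.
  rewrite -scaler_suml; congr (_ *: _).
  rewrite -{1}GTh mxE; apply: eq_bigr => l _.
  by rewrite mulrC.
under eq_bigr => l _ do rewrite scalerA.
rewrite -scaler_suml; have -> : \sum_l t l 0 * (p.1 *m D2 *m Th) 0 l =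
    (p.1 *m D2 *m Th *m t) 0 0.
  by rewrite [RHS]mxE; apply: eq_bigr => l _; rewrite mulrC.
rewrite -mulmxA -hTh.
have -> : (p.1 *m D2 *m col q D1) 0 0 = (p.1 *m D2 *m D1) 0 q.
  by rewrite !mxE; apply: eq_bigr => k _; rewrite !mxE.
have -> : p.1 *m D2 *m D1 = 0 by apply/ex2; exists p.1.
by rewrite mxE scale0r.
Qed.

End SocleColumn.

(** * The quotient by the socle *)

Section SocleQuotient.
Variables (R : comNzRingType) (m : set R) (S : comNzRingType) (pi : {rmorphism R -> S}).
Hypotheses (mloc : local_ring m) (pi_surj : forall s, exists r, pi r = s)
  (pi_ker : forall r, pi r = 0 <-> socle m r).

Definition image_ideal : set S := [set s | exists2 r, m r & pi r = s]%classic.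
Local Notation n := image_ideal.

Lemma socle_sub r : socle m r -> m r.
Proof.
move=> sr; apply: contrapT => /(local_unit mloc) [y ry].
have /pi_ker p0 := sr; have /eqP := oner_neq0 S; apply.
by rewrite -(rmorph1 pi) -ry rmorphM p0 mul0r.
Qed.

Lemma mul_pi0 r a : pi r = 0 -> m a -> a * r = 0.
Proof. by move=> /pi_ker h /h. Qed.

Lemma image_ideal_pi r : n (pi r) -> m r.
Proof.
move=> [r' mr' e]; rewrite -[r](subrK r'); apply: idealD => //.
  exact: local_ideal.
by apply: socle_sub; apply/pi_ker; rewrite rmorphB e subrr.
Qed.

Lemma image_ideal_ideal : is_ideal n.
Proof.
have hm := local_ideal mloc.
split=> [|_ _ [x mx <-] [y my <-]|a _ [x mx <-]].
- by exists 0; [exact: ideal0|rewrite rmorph0].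
- by exists (x + y); [exact: idealD|rewrite rmorphD].
- have [r <-] := pi_surj a.
  by exists (r * x); [exact: idealMl|rewrite rmorphM].
Qed.

Lemma image_ideal_unit s : ~ n s -> exists y, s * y = 1.
Proof.
have [r <-] := pi_surj s => nr.
have [|y ry] := @local_unit _ _ mloc r; first by move=> mr; apply: nr; exists r.
by exists (pi y); rewrite -rmorphM ry rmorph1.
Qed.

Lemma image_noetherian : noetherian_ring S.
Proof.
move=> J hJ Jinc; have Rnoeth : noetherian_ring R by case: mloc.
have [|k x /=|N hN] := Rnoeth (fun k => [set r | J k (pi r)]%classic).
- move=> k; split=> /= [|x y|a x]; first by rewrite rmorph0; apply: ideal0.
    by rewrite rmorphD; apply: idealD.
  by rewrite rmorphM; apply: idealMl.
- exact: Jinc.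
exists N => k /hN e; apply/funext => s; have [r <-] := pi_surj s.
exact: (congr1 (fun E : set R => E r) e).
Qed.

Lemma image_loewy Z h : loewy m Z h ->
  loewy n (fun i => [set s | exists2 r, Z i r & pi r = s]%classic) h.
Proof.
move=> [Z0 Z1 ZS]; split=> [_ [r /Z0 -> <-]||i _ _ [r Zr <-] [a ma <-]].
- exact: rmorph0.
- by exists 1; rewrite ?rmorph1.
- by exists (a * r); rewrite ?rmorphM //; apply: ZS.
Qed.

(** A matrix vanishing over [S] has socle entries. This and the mirror lemma handle lifted
    complexes, whose products over [R] need not vanish. *)
Lemma mulmx_ker_r p q k (X : 'M[R]_(p, q)) (Y : 'M[R]_(q, k)) :
  entries_in m X -> map_mx pi Y = 0 -> X *m Y = 0.
Proof.
move=> mX /matrixP Y0; apply/matrixP => i j; rewrite !mxE; apply: big1 => l _.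
by have := Y0 l j; rewrite !mxE => /mul_pi0; apply.
Qed.

Lemma mulmx_ker_l p q k (X : 'M[R]_(p, q)) (Y : 'M[R]_(q, k)) :
  map_mx pi X = 0 -> entries_in m Y -> X *m Y = 0.
Proof.
move=> /matrixP X0 mY; apply/matrixP => i j; rewrite !mxE; apply: big1 => l _.
by have := X0 i l; rewrite !mxE mulrC => /mul_pi0; apply.
Qed.

Lemma lift_mx p q (X : 'M[S]_(p, q)) : exists Y : 'M[R]_(p, q), map_mx pi Y = X.
Proof.
have /choice [f hf] := pi_surj.
by exists (map_mx f X); apply/matrixP => i j; rewrite !mxE.
Qed.

Lemma lift_entries p q (X : 'M[R]_(p, q)) : entries_in n (map_mx pi X) -> entries_in m X.
Proof. by move=> h i j; apply: image_ideal_pi; have := h i j; rewrite mxE. Qed.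

Local Notation J := (second_socle_ann m).

Section Columns.
Variables (Z : nat -> set R) (h : nat).
Hypothesis hZ : loewy m Z h.
Variables (c0 c1 c2 c3 c4 : nat) (D1 : 'M[S]_(c1, c0)) (D2 : 'M[S]_(c2, c1))
  (D3 : 'M[S]_(c3, c2)) (D4 : 'M[S]_(c4, c3)).
Hypotheses (ex1 : exact_at D2 D1) (ex2 : exact_at D3 D2) (ex3 : exact_at D4 D3).
Hypotheses (n1 : entries_in n D1) (n3 : entries_in n D3).
Hypotheses (D1_neq0 : D1 <> 0).

(** A unit in [second_socle] would put [m] inside the socle and make [D1] vanish; so [second_socle]
    lies in [m]. *)
Lemma socle_sub_ann c : socle m c -> J c.
Proof.
move=> sc r hr; apply: sc; apply: contrapT => /(local_unit mloc) [y ry].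
apply: D1_neq0; apply/matrixP => i j; rewrite !mxE.
have [a ma <-] := n1 i j; apply/pi_ker.
have := hr a ma => sar b mb.
by rewrite -[a]mulr1 -ry !mulrA -(mulrA b) sar // mul0r.
Qed.

Hypothesis not_principal : forall a, m a -> exists2 b, m b & ~ adjoin J a b.

Lemma exact_mulmx0 p q k (X : 'M[S]_(k, q)) (Y : 'M[S]_(q, p)) : exact_at X Y -> X *m Y = 0.
Proof.
move=> ex; apply/row_matrixP => i; rewrite row_mul row0; apply/ex.
by exists (delta_mx 0 i); rewrite rowE.
Qed.

(* The Koszul relation between [a v] and [b v], for [v] a preimage of a socle
   element, is a syzygy that cannot have all its coefficients in [J]. *)
Lemma entry_notin_ann (D3' : 'M[R]_(c3, c2)) : map_mx pi D3' = D3 ->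
  exists i k, ~ J (D3' i k).
Proof.
move=> eD3; apply: contrapT => hJ.
have {}hJ : entries_in J D3' by move=> i k; apply: contrapT => nJ; apply: hJ; exists i, k.
have hm := local_ideal mloc; have hJid := second_socle_ann_ideal m.
have [v [v0 nv]] : exists v : 'rV[S]_c1, v *m D1 != 0 /\ forall a, n a -> a *: (v *m D1) = 0.
  have [i Di] : exists i, row i D1 != 0.
    apply: contrapT => hD; apply: D1_neq0; apply/row_matrixP => i; rewrite row0.
    by apply/eqP/negPn/negP => hi; apply: hD; exists i.
  have [a [a0 na]] := ex_socle_multiple (image_loewy hZ) Di.
  by exists (a *: delta_mx 0 i); rewrite -scalemxAl -rowE.
have [l vl] : exists l, (v *m D1) 0 l != 0.
  apply: contrapT => hl; case/eqP: v0; apply/rowP => l; rewrite [RHS]mxE.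
  by apply/eqP/negPn/negP => hl'; apply: hl; exists l.
have [V eV] := lift_mx v; have [E1 eD1] := lift_mx D1; have [E2 eD2] := lift_mx D2.
have [a ma ar] : exists2 a, m a & a * (V *m E1) 0 l <> 0.
  apply: contrapT => ha; case/eqP: vl.
  have -> : (v *m D1) 0 l = pi ((V *m E1) 0 l) by rewrite -eV -eD1 -map_mxM mxE.
  by apply/pi_ker => a ma; apply: contrapT => har; apply: ha; exists a.
have syz c : m c -> exists z : 'rV[S]_c2, pi c *: v = z *m D2.
  by move=> mc; apply/ex1; rewrite -scalemxAl nv //; exists c.
have [b mb nb] := not_principal ma.
have [za hza] := syz a ma; have [zb hzb] := syz b mb.
have [y hy] : row_span D3 (pi b *: za - pi a *: zb).
  apply/ex2; rewrite mulmxBl -!scalemxAl -hza -hzb !scalerA mulrC subrr //.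
have [Y eY] := lift_mx y; have [za' eza] := lift_mx za; have [zb' ezb] := lift_mx zb.
(* The entries of [b *: za' - a *: zb'] lie in [J]; dividing by a unit entry of [za'] would put [b]
   in [Ra + J]. *)
have mza : entries_in m za'.
  move=> i p; rewrite ord1 {i}; apply: contrapT => /(local_unit mloc) [u zu].
  apply: nb; pose j := (Y *m D3') 0 p.
  have Jj : J j by rewrite /j mxE; apply: ideal_sum => // i _; exact: (idealMl _ hJid (hJ i p)).
  exists (b - a * zb' 0 p * u); last by exists (zb' 0 p * u); ring.
  have : J ((b * za' 0 p - a * zb' 0 p - j) * u).
    apply: (idealMr _ hJid); apply: socle_sub_ann; apply/pi_ker.
    rewrite !rmorphB !rmorphM /=; apply/eqP; rewrite subr_eq0; apply/eqP.
    have -> : pi j = (y *m D3) 0 p by rewrite -eY -eD3 -map_mxM mxE.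
    by rewrite -hy -eza -ezb !mxE.
  have Jju : J (j * u) by exact: (idealMr _ hJid).
  move=> h1; have := idealD hJid h1 Jju.
  have -> : (b * za' 0 p - a * zb' 0 p - j) * u + j * u =
    b * (za' 0 p * u) - a * zb' 0 p * u by ring.
  by rewrite zu mulr1.
(* So [a *: V *m E1] equals [za' *m E2 *m E1], which is zero because [E2 *m E1] has socle entries
   and [za'] has entries in [m]. *)
apply: ar; have e0 : (za' *m E2 - a *: V) *m E1 = 0.
  apply: mulmx_ker_l; last by apply: lift_entries; rewrite eD1.
  by rewrite map_mxB map_mxM map_mxZ eza eD2 eV hza subrr.
have e1 : za' *m E2 *m E1 = 0.
  rewrite -mulmxA; apply: mulmx_ker_r => //.
  by rewrite map_mxM eD1 eD2 exact_mulmx0.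
move: e0; rewrite mulmxBl e1 sub0r -scalemxAl => /rowP /(_ l).
by rewrite !mxE => /eqP; rewrite oppr_eq0 => /eqP.
Qed.

(** For [r] in [second_socle] not killing the entry [E3 i k], [pi r *: delta_mx 0 i] is a cycle
    [e *m D4]. If [e] had all its entries in [n], lifting to [R] would give [r * E3 i k = 0].
    Rescaling makes an entry of [e] equal to 1. *)
Lemma ex_socle_column :
  exists (e : 'rV[S]_c4) q, e 0 q = 1 /\ forall a, n a -> a *: (e *m D4) = 0.
Proof.
have [E3 eD3] := lift_mx D3; have [E4 eD4] := lift_mx D4.
have [i [k nJ]] := entry_notin_ann eD3.
have [r [r2 rt]] : exists r, second_socle m r /\ r * E3 i k <> 0.
  apply: contrapT => hr; apply: nJ => r r2; apply: contrapT => hr0; apply: hr; by exists r.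
have nr a : n a -> a * pi r = 0.
  by move=> [b mb <-]; rewrite -rmorphM; apply/pi_ker; apply: r2.
have [e he] : row_span D4 (pi r *: delta_mx 0 i).
  apply/ex3; rewrite -scalemxAl -rowE; apply/rowP => j; rewrite !mxE mulrC.
  exact/nr/n3.
have [q nq] : exists q, ~ n (e 0 q).
  apply: contrapT => ne; apply: rt; have [e' ee'] := lift_mx e.
  have me' : entries_in m e'.
    apply: lift_entries => x q; rewrite ord1 ee'; apply: contrapT => h1.
    by apply: ne; exists q.
  have e0 : (e' *m E4 - r *: delta_mx 0 i) *m E3 = 0.
    apply: mulmx_ker_l; last by apply: lift_entries; rewrite eD3.
    by rewrite map_mxB map_mxM map_mxZ map_delta_mx ee' eD4 -he subrr.
  have e1 : e' *m E4 *m E3 = 0.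
    rewrite -mulmxA; apply: mulmx_ker_r => //.
    by rewrite map_mxM eD3 eD4 exact_mulmx0.
  move: e0; rewrite mulmxBl e1 sub0r -scalemxAl -rowE => /rowP /(_ k).
  by rewrite !mxE => /eqP; rewrite oppr_eq0 => /eqP.
have [u qu] := image_ideal_unit nq.
exists (u *: e), q; split=> [|a na]; first by rewrite mxE mulrC.
rewrite -scalemxAl -he !scalerA mulrAC nr ?mul0r ?scale0r //.
Qed.

End Columns.
End SocleQuotient.

(** * Principal ideal rings *)

Section PrincipalIdealRing.
Variables (S : comNzRingType) (n : set S) (a : S).
Hypotheses (n_ideal : is_ideal n) (n_unit : forall x, ~ n x -> exists y, x * y = 1).
Hypotheses (na : n a) (n_gen : forall x, n x -> exists c, x = c * a).
Variable H : nat.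
Hypotheses (aH : a ^+ H = 0) (aH_min : forall k, a ^+ k = 0 -> (H <= k)%N).

Lemma expn_in k : (0 < k)%N -> n (a ^+ k).
Proof. by case: k => // k _; rewrite exprS; apply: idealMr. Qed.

(** Take the highest power of [a] dividing all values of [F]. The index type covers a single
    element, a matrix, or all relations of [N] at once. *)
Lemma factor_power (T : Type) (F : T -> S) : (exists k, F k <> 0) ->
  exists i, [/\ (i < H)%N & exists G : T -> S,
    (forall k, F k = a ^+ i * G k) /\ exists k, ~ n (G k)].
Proof.
move=> [k0 Fk0].
have bnd i : `[< forall k, exists y, F k = a ^+ i * y >] -> (i <= H.-1)%N.
  move=> /asboolP Fi; case: (leqP i H.-1) => // Hi; case: Fk0.
  have [y ->] := Fi k0.
  have -> : i = (H + (i - H))%N by rewrite subnKC // (leq_trans (leqSpred H)).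
  by rewrite exprD aH !mul0r.
have P0 : exists i, `[< forall k, exists y, F k = a ^+ i * y >].
  by exists 0%N; apply/asboolP => k; exists (F k); rewrite expr0 mul1r.
case: (ex_maxnP P0 bnd) => i /[dup] /bnd iH /asboolP /choice [G hG] maxi; exists i.
have H0 : (0 < H)%N.
  rewrite lt0n; apply/eqP => H0; have /eqP := oner_neq0 S; apply.
  by rewrite -(expr0 a) -{1}H0.
split; first by rewrite -(prednK H0) ltnS.
exists G; split=> //; apply: contrapT => hn.
suff : (i.+1 <= i)%N by rewrite ltnn.
apply: maxi; apply/asboolP => k; have nGk : n (G k).
  by apply: contrapT => nk; apply: hn; exists k.
by have [c e] := n_gen nGk; exists c; rewrite hG e exprSr -mulrA (mulrC a).
Qed.

(** A nonzero [x] is [a ^+ j] times a unit, and [a ^+ (i + j) = 0] forces [H <= i + j]. *)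
Lemma annihilator_power i x : a ^+ i * x = 0 -> exists c, x = a ^+ (H - i) * c.
Proof.
move=> ax; case: (pselect (x = 0)) => [->|x0]; first by exists 0; rewrite mulr0.
have [|j [_ [G [xE [[] nG]]]]] := @factor_power unit (fun _ => x); first by exists tt.
have [u Gu] := n_unit nG; have {}xE := xE tt.
have /aH_min Hij : a ^+ (i + j) = 0.
  by rewrite -[LHS]mulr1 -Gu exprD mulrA -(mulrA (a ^+ i)) -xE ax mul0r.
exists (a ^+ (j - (H - i)) * G tt).
by rewrite mulrA -exprD subnKC -?xE // leq_subLR.
Qed.

(* With [D0 = a^i D], exactness at [D0] after tensoring with [N] says that every
   element of [N] killed by [a^i] lies in [a^(H-i) N]. *)
Lemma principal_free (N : lmodType S) c (g : 'I_c -> N) c0 c1 c2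
    (D0 : 'M[S]_(c1, c0)) (D1 : 'M[S]_(c2, c1)) :
  (forall y, exists b : 'rV[S]_c, y = \sum_i b 0 i *: g i) ->
  (forall b : 'I_c -> S, \sum_i b i *: g i = 0 -> forall i, n (b i)) ->
  exact_at D1 D0 -> entries_in n D0 -> D0 <> 0 ->
  (forall z : seq ('rV[S]_c1 * N),
    (forall j, \sum_(p <- z) (p.1 *m D0) 0 j *: p.2 = 0) ->
    exists w : seq ('rV[S]_c2 * N), forall k,
      \sum_(p <- w) (p.1 *m D1) 0 k *: p.2 = \sum_(p <- z) p.1 0 k *: p.2) ->
  forall b : 'rV[S]_c, \sum_i b 0 i *: g i = 0 -> b = 0.
Proof.
move=> gsurj gmin ex1 nD0 D00 torex.
have [|i [iH [G [D0E [[k q] nG]]]]] := @factor_power ('I_c1 * 'I_c0) (fun p => D0 p.1 p.2).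
  apply: contrapT => hD; apply: D00; apply/matrixP => k q; rewrite mxE.
  by apply: contrapT => h; apply: hD; exists (k, q).
have i0 : (0 < i)%N.
  rewrite lt0n; apply/eqP => i0; apply: nG.
  by have := nD0 k q; rewrite (D0E (k, q)) i0 expr0 mul1r.
(* The tensor of [delta_mx 0 k] with [y] is a cycle, hence a boundary. Weighting coordinates by
   [G (l, q)] turns it into [G (k, q) *: y], with a unit coefficient, and the boundary into a
   multiple of [a ^+ (H - i)]. *)
have Ndiv (y : N) : a ^+ i *: y = 0 -> exists y', y = a ^+ (H - i) *: y'.
  move=> ay; have [|w hw] := torex [:: (delta_mx 0 k, y)].
    by move=> j; rewrite big_seq1 /= -rowE mxE (D0E (k, j)) /= mulrC -scalerA ay scaler0.
  have [u Gu] := n_unit nG.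
  have /choice [f hf] (x : 'rV[S]_c2) : exists d,
      \sum_l (x *m D1) 0 l * G (l, q) = a ^+ (H - i) * d.
    apply: annihilator_power; have /ex1 /rowP /(_ q) : row_span D1 (x *m D1) by exists x.
    rewrite !mxE => {2}<-; rewrite mulr_sumr; apply: eq_bigr => l _.
    by rewrite (D0E (l, q)) /= mulrCA.
  exists (\sum_(p <- w) (u * f p.1) *: p.2).
  have yE : G (k, q) *: y = \sum_(p <- w) (\sum_l (p.1 *m D1) 0 l * G (l, q)) *: p.2.
    under eq_bigr => p _ do rewrite scaler_suml.
    rewrite exchange_big /= (bigD1 k) //= [X in _ + X]big1 ?addr0 => [|l lk];
      under eq_bigr => p _ do rewrite mulrC -scalerA; rewrite -scaler_sumr hw big_seq1 /= mxE.
      by rewrite !eqxx scale1r.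
    by rewrite (negbTE lk) scale0r scaler0.
  rewrite -[LHS]scale1r -Gu mulrC -scalerA yE !scaler_sumr; apply: eq_bigr => p _.
  by rewrite hf !scalerA; congr (_ *: _); rewrite mulrCA.
move=> x Kx; apply: contrapT => x0.
pose K (b : 'rV[S]_c) := \sum_i b 0 i *: g i = 0.
(* [a ^+ j] is the highest power dividing every coordinate of every relation, and [b] attains it at
   [l]. *)
have [|j [jH [G' [KE [[[b Kb] l] nl]]]]] :=
    @factor_power ({b | K b} * 'I_c) (fun p => sval p.1 0 p.2).
  apply: contrapT => hx; apply: x0; apply/rowP => l; rewrite [RHS]mxE.
  by apply: contrapT => xl; apply: hx; exists (exist _ x Kx, l).
pose b' : 'rV[S]_c := \row_l G' (exist _ b Kb, l).
have bE : b = a ^+ j *: b'.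
  by apply/rowP => l'; rewrite !mxE -(KE (exist _ b Kb, l')).
have nb' : ~ n (b' 0 l) by rewrite mxE.
have Kpow y z (b1 b2 : 'rV[S]_c) : y *: row_comb g b1 = z *: row_comb g b2 ->
    K (y *: b1 - z *: b2).
  move=> e; rewrite /K -/(row_comb g _) linearB [X in X - _]linearZ [X in _ - X]linearZ /=.
  by rewrite e subrr.
have ab' : a ^+ j *: row_comb g b' = 0.
  by rewrite -linearZ /= -bE; apply: Kb.
have nHi : n (a ^+ (H - i)) by apply: expn_in; rewrite subn_gt0.
(* If [j <= i], then [b'] is [a ^+ (H - i) *: d] plus a relation, and both have entries in [n]. *)
case: (leqP j i) => ij.
  have [|y'] := Ndiv (row_comb g b').
    by rewrite -(subnK ij) exprD -scalerA ab' scaler0.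
  have [d -> e] := gsurj y'.
  have := Kpow 1 (a ^+ (H - i)) b' d; rewrite !scale1r => /(_ e) /gmin /(_ l).
  rewrite !mxE => h; apply: nb'; rewrite mxE -[X in n X](subrK (a ^+ (H - i) * d 0 l)).
  by apply: idealD => //; apply: idealMr.
(* If [i < j], the relation [a ^+ (j - i) *: b' - a ^+ (H - i) *: d] is again divisible by [a ^+ j].
   At [l], factoring out [a ^+ (j - i)] leaves a unit, so [a ^+ (j - i) = 0] although
   [j - i < H]. *)
have [|y'] := Ndiv (a ^+ (j - i) *: row_comb g b').
  by rewrite scalerA -exprD subnKC ?ab' // ltnW.
have [d -> /Kpow Kd] := gsurj y'.
pose e := G' (exist _ _ Kd, l).
have := KE (exist _ _ Kd, l); rewrite /= -/e !mxE => de.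
have /n_unit [u hu] : ~ n (b' 0 l - a ^+ (H - j) * d 0 l - a ^+ i * e).
  move=> h; apply: nb'.
  rewrite -[b' 0 l](subrK (a ^+ (H - j) * d 0 l)) -[X in n (X + _)](subrK (a ^+ i * e)).
  apply: idealD => //; first apply: idealD => //; apply: idealMr => //; apply: expn_in => //.
  by rewrite subn_gt0.
suff /aH_min : a ^+ (j - i) = 0.
  by rewrite leqNgt (leq_ltn_trans (leq_subr _ _) jH).
rewrite -[LHS]mulr1 -hu mulrA !mulrBr !mulrA -!exprD (subnK (ltnW ij)).
have -> : (j - i + (H - j) = H - i)%N by rewrite addnC addnBA ?(ltnW ij) // subnK // ltnW.
by rewrite mxE de subrr mul0r.
Qed.

End PrincipalIdealRing.

(** * Nonvanishing of the differentials, and the conclusion *)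

Lemma loewy_expn (A : comNzRingType) (m : set A) (Z : nat -> set A) h a :
  loewy m Z h -> m a -> a ^+ h = 0.
Proof.
move=> [Z0 Z1 ZS] ma; apply: Z0; rewrite -(subnn h).
suff : forall k, (k <= h)%N -> Z (h - k)%N (a ^+ k) by apply.
elim=> [_|k IH kh]; first by rewrite subn0 expr0.
by rewrite exprS; apply: ZS => //; rewrite -subSn // subSS; apply/IH/ltnW.
Qed.

(** If [D i.+1] vanished, [D i] would be injective; but it kills socle multiples of basis vectors,
    so it would have no rows. *)
Lemma minimal_resolution_neq0 (S : comNzRingType) (n : set S) (Z : nat -> set S) h
    (b : nat -> nat) (D : forall i, 'M[S]_(b i.+1, b i)) :
  loewy n Z h -> (forall i, exact_at (D i.+1) (D i)) ->
  (forall i, entries_in n (D i)) -> D 0%N <> 0 -> forall i, D i <> 0.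
Proof.
move=> hZ ex nD D0; elim=> // i IH DS; apply: IH; apply/matrixP => k j.
have [s [s0 ns]] := ex_socle hZ.
have : row_span (D i.+1) (s *: delta_mx 0 k).
  apply/ex; rewrite -scalemxAl -rowE; apply/rowP => l; rewrite !mxE mulrC.
  exact/ns/nD.
move=> [z]; rewrite DS mulmx0 => /rowP /(_ k); rewrite !mxE !eqxx mulr1 => e.
by rewrite e eqxx in s0.
Qed.

(* R/soc R is given by a surjective ring morphism with kernel soc R. *)
Theorem proposition4p5 (R : comNzRingType) (m : set R)
    (S : comNzRingType) (pi : {rmorphism R -> S}) :
  local_ring m -> artinian_ring R -> generalized_golod m ->
  gorenstein_ring R -> ~ is_field R ->
  (forall s, exists r, pi r = s) ->
  (forall r, pi r = 0 <-> socle m r) ->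
  tor_vanishing S.
Proof.
move=> mloc Rart _ Rgor _ pi_surj pi_ker M N Mfg Nfg [n0 tor0].
pose n := image_ideal m pi.
have n_ideal : is_ideal n := image_ideal_ideal mloc pi_surj.
have n_unit s : ~ n s -> exists y, s * y = 1 := image_ideal_unit mloc pi_surj (s := s).
have Snoeth : noetherian_ring S := image_noetherian mloc pi_surj.
have [h hZ] := artinian_loewy mloc Rart; have nZ := image_loewy pi hZ.
have [b [D [g [g_surj g_exact D_exact nD]]]] := minimal_resolution n_unit Snoeth Mfg.
(* If [D 0] vanishes, [M] is free; otherwise no differential vanishes, and [N] is shown to be
   free. *)
case: (pselect (D 0%N = 0)) => [D0|/(minimal_resolution_neq0 nZ D_exact nD) Dneq0].
  left; apply: (free_finite_projective_dimension g_surj) => a /g_exact [z ->].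
  by rewrite D0 mulmx0.
right; have [p [gN0 gN0_span]] := Nfg.
have [|c [gN [N_span N_min]]] := @minimal_generators S n n_unit N (fun _ => True) p gN0.
  by move=> x; split=> // _; apply: gN0_span.
have N_surj y : exists a : 'rV[S]_c, y = \sum_i a 0 i *: gN i.
  have [a ->] := (N_span y).1 Logic.I.
  by exists (\row_i a i); apply: eq_bigr => i _; rewrite mxE.
apply: (free_finite_projective_dimension N_surj).
have torex k (hk : (n0 <= k)%N) z :=
  @tor_exact S M b D g g_surj g_exact D_exact N k z (tor0 k.+1 (leqW hk)).
case: (pselect (forall a, m a -> exists2 x, m x & ~ adjoin (second_socle_ann m) a x)).
  move=> not_principal.
  (* The socle element lies in the image of [D n0.+3], so the vanishing of Tor is used for the pair
     [D n0.+4], [D n0.+5]. *)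
  have [e [q [eq1 e_soc]]] := ex_socle_column mloc pi_surj pi_ker hZ
    (D_exact n0) (D_exact n0.+1) (D_exact n0.+2) (nD _) (nD _) (Dneq0 n0) not_principal.
  apply: (socle_column_free n_ideal Snoeth nZ N_surj N_min (D_exact _) (D_exact _) (nD _)
    eq1 e_soc).
  by apply: torex; rewrite !leqW.
move=> /existsNP [a /not_implyP [ma hma]].
have m_gen : forall x, m x -> exists y, x = y * a.
  apply: (gorenstein_principal mloc hZ Rgor ma) => x mx.
  by apply: contrapT => nx; apply: hma; exists x.
have na : n (pi a) by exists a.
have n_gen x : n x -> exists y, x = y * pi a.
  by move=> [r /m_gen [y ->] <-]; exists (pi y); rewrite rmorphM.
have ex_nil : exists k, pi a ^+ k == 0 by exists h; rewrite (loewy_expn nZ na).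
case: (ex_minnP ex_nil) => H /eqP aH minH.
apply: (principal_free n_ideal n_unit na n_gen aH _ N_surj N_min (D_exact n0) (nD _) (Dneq0 n0)).
  by move=> k /eqP; apply: minH.
exact: torex.
Qed.
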